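(* Let $m,n\ge 0$, $q_M=m+2$, $1\le u<v\le q_M$, let $M$ be the graded Dieudonné module $M^{[q_M]}_{u,v}$ and $N$ the graded Dieudonné module $N=N_1\oplus N_2$ described below, and let $L=M\oplus N^{n}$ with $L_i=M_i\oplus N_i^{n}$. Let $r_2$ be the second smallest element (counted with multiplicity) of the multiset $\{u,\ v,\ q_M-v+2,\ q_M-u+1\}$. Then the Ekedahl–Oort index of $L$ in $\mathbf W(m+n,2)$ is $\gamma_{y,s}$, where $$y=\begin{cases}u & \text{if } u\le r_2,\\ u+n & \text{if } u>r_2,\end{cases}\qquad s=\begin{cases}v & \text{if } v\le r_2,\\ v+n & \text{if } v>r_2.\end{cases}$$
   Context: Let $k$ be an algebraic closure of $\mathbb F_p$, $p>2$. A (mod $p$) Dieudonné module is a finite-dimensional $k$-vector space with a Frobenius-semilinear $F$ and Frobenius$^{-1}$-semilinear $V$; it is graded if $L=L_1\oplus L_2$ with $F(L_i),V(L_i)\subseteq L_{3-i}$. For a subspace $W$, $V^{-1}(W)=\{x:V(x)\in W\}$. A final filtration is a full flag $0=W_0\subset\cdots\subset W_{\dim L}=L$, $\dim W_j=j$, with $F(W_j)$ and $V^{-1}(W_j)$ members of the flag for all $j$. Ekedahl–Oort index: if $L$ is graded with $\dim L_1=c+2$ and $\dim(L_1\cap\ker F)=2$, take a final filtration, let $E_t$ be the $t$-dimensional member of $\{W_j\cap L_1\}$ ($0\le t\le c+2$), and $\eta_1(t)=\dim(E_t\cap\ker F)$; $\eta_1$ increases exactly at two indices $u'<v'$ (independently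 of the final filtration), and the index is $\gamma_{u',v'}=(2,\dots,v')(1,\dots,u')\in\mathbf W(c,2)$ (permutations composed right to left). The module $M^{[Q]}_{u,v}$ ($1\le u<v\le Q$; standard object of the Ekedahl–Oort stratum $\gamma_{u,v}$ of $\mathcal M(Q-2,2)$): basis $e_{i,j}$, $i\in\{1,2\}$, $1\le j\le Q$, $M_i=\mathrm{span}\{e_{i,j}\}_j$, with $F,V$ the semilinear extensions of $F(e_{1,j})=0$ if $j\in\{u,v\}$; $=e_{2,j}$ if $1\le j\le u-1$; $=e_{2,j-1}$ if $u<j\le v-1$; $=e_{2,j-2}$ if $j>v$. $V(e_{1,j})=0$ if $j\in\{1,2\}$; $=e_{2,j-2}$ if $2<j\le Q-v+2$; $=e_{2,j-1}$ if $Q-v+2<j\le Q-u+1$; $=e_{2,j}$ if $j>Q-u+1$. $F(e_{2,j})=e_{1,1}$ if $j=Q-v+1$; $=e_{1,2}$ if $j=Q-u+1$; $=0$ otherwise. $V(e_{2,j})=e_{1,u}$ if $j=Q-1$; $=e_{1,v}$ if $j=Q$; $=0$ otherwise. The module $N$ (Dieudonné module of $E[p]$ for a supersingular elliptic curve $E$ with $\mathcal O_K$-action of signature $(1,0)$): $N=N_1\oplus N_2$ with $N_1=k f_1$, $N_2=kf_2$, $F(f_1)=V(f_1)=f_2$, $F(f_2)=V(f_2)=0$ (so $F(N_1)=V(N_1)=N_2$, $F(N_2)=V(N_2)=0$). *)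

(* Defs.v *)
From HB Require Import structures.
From mathcomp Require Import all_boot all_order all_algebra all_fingroup.

Set Implicit Arguments.
Unset Strict Implicit.
Unset Printing Implicit Defensive.

Import GRing.Theory.
Local Open Scope ring_scope.

(* k is an algebraically closed field of characteristic p; the theorem
   additionally requires k to be algebraic over F_p. *)

Section Frobenius.
Variables (p : nat) (k : closedFieldType) (chk : p \in [pchar k]).

Definition frob : {rmorphism k -> k} := pFrobenius_aut chk.

Lemma frob_surj (a : k) : exists b : k, frob b == a.
Proof.
have p_gt0 : (0 < p)%N by rewrite prime_gt0 // (pcharf_prime chk).
have /closed_rootP [b] : size ('X^p - a%:P) != 1%N.
  by rewrite size_XnsubC // eqSS -lt0n.
rewrite rootE !hornerE subr_eq0 => /eqP ba.
by exists b; rewrite -ba.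
Qed.

Definition frobV (a : k) : k := xchoose (frob_surj a).

Lemma frobVK : cancel frobV frob.
Proof. by move=> a; apply/eqP; exact: (xchooseP (frob_surj a)). Qed.

Lemma frobK : cancel frob frobV.
Proof. by move=> a; apply: (fmorph_inj frob); rewrite frobVK. Qed.

Fact frobV_is_nmod_morphism : nmod_morphism frobV.
Proof.
split=> [|a b]; apply: (can_inj frobK); rewrite frobVK ?rmorph0 //.
by rewrite rmorphD /= !frobVK.
Qed.

Fact frobV_is_monoid_morphism : monoid_morphism frobV.
Proof.
split=> [|a b]; apply: (can_inj frobK); rewrite frobVK ?rmorph1 //.
by rewrite rmorphM /= !frobVK.
Qed.

HB.instance Definition _ := GRing.isNmodMorphism.Build k k frobV
  frobV_is_nmod_morphism.
HB.instance Definition _ := GRing.isMonoidMorphism.Build k k frobV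
  frobV_is_monoid_morphism.

End Frobenius.

Definition semilinear (k : fieldType) (tau : k -> k) (L L' : vectType k)
    (f : L -> L') : Prop :=
  forall (a : k) (x y : L), f (a *: x + y) = tau a *: f x + f y.

Definition maps_into (k : fieldType) (L L' : vectType k) (f : L -> L')
    (U : {vspace L}) (W : {vspace L'}) : Prop :=
  forall x, x \in U -> f x \in W.

Lemma semilinear0 (k : fieldType) (tau : {rmorphism k -> k})
    (L L' : vectType k) (f : L -> L') : semilinear tau f -> f 0 = 0.
Proof.
by move=> /(_ (-1) 0 0); rewrite scaler0 addr0 rmorphN1 scaleN1r addNr.
Qed.

Section Dieudonne.
Variables (p : nat) (k : closedFieldType) (chk : p \in [pchar k]).

Record dieudonne := Dieudonne {
  dm_space :> vectType k;
  dmF : dm_space -> dm_space;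
  dmV : dm_space -> dm_space;
  dmF_semilinear : semilinear (frob chk) dmF;
  dmV_semilinear : semilinear (frobV chk) dmV }.

Record graded_dieudonne := GradedDieudonne {
  gd_mod :> dieudonne;
  gd1 : {vspace gd_mod};
  gd2 : {vspace gd_mod};
  gd_sum : (gd1 + gd2 = fullv)%VS;
  gd_cap : (gd1 :&: gd2 = 0)%VS;
  gdF1 : maps_into (@dmF gd_mod) gd1 gd2;
  gdF2 : maps_into (@dmF gd_mod) gd2 gd1;
  gdV1 : maps_into (@dmV gd_mod) gd1 gd2;
  gdV2 : maps_into (@dmV gd_mod) gd2 gd1 }.

(* Composing F with the bijective coordinatewise inverse Frobenius gives a
   k-linear map with the same kernel; see memv_kerF. *)
Section Kernel.
Variable L : dieudonne.

Definition untwist (x : L) : L :=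
  \sum_i frobV chk (coord (vbasis fullv) i x) *: (vbasis (fullv : {vspace L}))`_i.

Definition kerF : {vspace L} := lker (linfun (untwist \o @dmF L)).

Lemma untwist_eq0 x : (untwist x == 0) = (x == 0).
Proof.
have fr : free (vbasis (fullv : {vspace L})) := basis_free (vbasisP _).
apply/eqP/eqP=> [x0|->]; last first.
  by rewrite /untwist big1 // => i _; rewrite linear0 rmorph0 scale0r.
rewrite (coord_vbasis (memvf x)); apply: big1 => i _.
have /(congr1 (coord (vbasis fullv) i)) := x0.
rewrite /untwist coord_sum_free // linear0 => /eqP.
by rewrite fmorph_eq0 => /eqP ->; rewrite scale0r.
Qed.

Fact untwistF_is_linear : linear (untwist \o @dmF L).
Proof.
move=> a x y /=; rewrite dmF_semilinear /untwist scaler_sumr -big_split /=.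
apply: eq_bigr => i _.
by rewrite linearP /= rmorphD rmorphM /= frobK scalerDl scalerA.
Qed.

Lemma memv_kerF x : (x \in kerF) = (dmF x == 0).
Proof.
pose h := GRing.isLinear.Build _ _ _ _ _ untwistF_is_linear.
pose f : {linear L -> L} := HB.pack (untwist \o @dmF L) h.
by rewrite /kerF memv_ker -[untwist \o _]/(f : L -> L) lfunE /= untwist_eq0.
Qed.

End Kernel.

Definition final_filtration (L : dieudonne)
    (W : 'I_(\dim {:L}).+1 -> {vspace L}) : Prop :=
  [/\ forall j, \dim (W j) = j,
      forall i j : 'I_(\dim {:L}).+1, (i <= j)%N -> (W i <= W j)%VS,
      forall j, exists i, forall y,
        y \in W i <-> exists2 x, x \in W j & y = dmF x
    & forall j, exists i, forall x, x \in W i <-> dmV x \in W j].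

(* The t-dimensional member of { W_j :&: L_1 } (the zero space if there is
   none, which does not occur for a full flag and t <= \dim L_1). *)
Definition flag1 (L : graded_dieudonne) (W : 'I_(\dim {:L}).+1 -> {vspace L})
    (t : nat) : {vspace L} :=
  if [pick j | \dim (W j :&: gd1 L) == t] is Some j then (W j :&: gd1 L)%VS
  else 0%VS.

Definition eta1 (L : graded_dieudonne) (W : 'I_(\dim {:L}).+1 -> {vspace L})
    (t : nat) : nat :=
  \dim (flag1 W t :&: kerF L).

End Dieudonne.

(* The cycle (a, a+1, ..., b) of {1, ..., d}; i : 'I_d stands for i + 1. *)
Definition cycle_perm (d a b : nat) : 'S_d :=
  perm (can_inj (prev_next
    (filter_uniq (fun i : 'I_d => a <= i.+1 <= b)%N (enum_uniq 'I_d)))).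

(* (2, ..., v)(1, ..., u) composed right to left; mathcomp's product of
   permutations applies its left factor first. *)
Definition gamma (c u v : nat) : 'S_(c + 2) :=
  (cycle_perm (c + 2) 1 u * cycle_perm (c + 2) 2 v)%g.

Definition EO_index (p : nat) (k : closedFieldType) (chk : p \in [pchar k])
    (L : graded_dieudonne chk) (c : nat) (w : 'S_(c + 2)) : Prop :=
  [/\ \dim (gd1 L) = (c + 2)%N,
      \dim (gd1 L :&: kerF L) = 2%N,
      exists W, final_filtration (L := L) W
    & forall W, final_filtration (L := L) W ->
      exists u' v' : nat,
        [/\ (1 <= u')%N, (u' < v')%N, (v' <= c + 2)%N,
            forall t, (1 <= t <= c + 2)%N ->
              (eta1 W t.-1 < eta1 W t)%N = (t == u') || (t == v')
          & w = gamma c u' v'] ].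
Arguments EO_index {p k chk} L c w.

Section BasisModules.
Variables (p : nat) (k : closedFieldType) (chk : p \in [pchar k]).
Variable Q : nat.

(* The basis vector e_{i,j}, with i in {1, 2} and 1 <= j <= Q. *)
Definition bvec (i j : nat) : 'M[k]_(2, Q) :=
  \matrix_(a < 2, b < Q) ((a.+1 == i) && (b.+1 == j))%:R.

Definition bspan (i : nat) : {vspace 'M[k]_(2, Q)} :=
  <<[seq bvec i j | j <- iota 1 Q]>>%VS.

Definition semi_ext (tau : k -> k) (phi : nat -> nat -> 'M[k]_(2, Q))
    (x : 'M[k]_(2, Q)) : 'M[k]_(2, Q) :=
  \sum_(a < 2) \sum_(b < Q) tau (x a b) *: phi a.+1 b.+1.

Fact semi_ext_semilinear (tau : {rmorphism k -> k}) phi :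
  semilinear tau (semi_ext tau phi).
Proof.
move=> c x y; rewrite /semi_ext scaler_sumr -big_split; apply: eq_bigr => a _ /=.
rewrite scaler_sumr -big_split; apply: eq_bigr => b _ /=.
by rewrite !mxE rmorphD rmorphM scalerDl scalerA.
Qed.

Definition basis_mod (phiF phiV : nat -> nat -> 'M[k]_(2, Q)) : dieudonne chk :=
  Dieudonne (semi_ext_semilinear (frob chk) phiF)
            (semi_ext_semilinear (frobV chk) phiV).

Lemma bvec_in i j : bvec i j \in bspan i.
Proof.
have [jQ|jQ] := boolP (j \in iota 1 Q).
  by apply/memv_span/map_f.
suff -> : bvec i j = 0 by rewrite mem0v.
apply/matrixP=> a b; rewrite !mxE; case: (b.+1 =P j) => [bj|]; last by rewrite andbF.
by case/negP: jQ; rewrite mem_iota -bj; exact: ltn_ord.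
Qed.

Lemma bspanP (i : 'I_2) (x : 'M[k]_(2, Q)) :
  reflect (forall a b, a != i -> x a b = 0) (x \in bspan i.+1).
Proof.
apply: (iffP idP) => [xi a b ai|x0].
  rewrite (coord_span (X := in_tuple _) xi) summxE big1 // => l _.
  rewrite (nth_map 0%N); last by case: l => l /=; rewrite size_map.
  by rewrite !mxE eqSS (inj_eq val_inj) (negPf ai) mulr0.
suff -> : x = \sum_(b < Q) x i b *: bvec i.+1 b.+1.
  by apply: memv_suml => b _; apply/memvZ/bvec_in.
apply/matrixP=> a b; rewrite summxE (bigD1 b) //= big1 => [|c cb]; last first.
  by rewrite !mxE !eqSS !(inj_eq val_inj) [b == c]eq_sym (negPf cb) andbF mulr0.
rewrite !mxE !eqSS (inj_eq val_inj) eqxx andbT addr0.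
have [->|/x0->] := eqVneq a i; first by rewrite mulr1.
by rewrite mulr0.
Qed.

Lemma bspan_sum : (bspan 1 + bspan 2 = fullv)%VS.
Proof.
apply/eqP; rewrite eqEsubv subvf; apply/subvP=> x _.
have -> : x = (\matrix_(a, b) (x a b *+ (a == ord0))) +
              (\matrix_(a, b) (x a b *+ (a != ord0))).
  by apply/matrixP=> a b; rewrite !mxE; case: eqP; rewrite ?addr0 ?add0r.
apply: memv_add.
  by apply/(bspanP ord0) => a b /negPf a0; rewrite mxE a0.
apply/(bspanP ord_max) => a b aM; rewrite mxE.
by case: a aM => -[|[|]].
Qed.

Lemma bspan_cap : (bspan 1 :&: bspan 2 = 0)%VS.
Proof.
apply/eqP; rewrite -subv0; apply/subvP=> x; rewrite memv_cap memv0.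
case/andP=> /(bspanP ord0) x1 /(bspanP ord_max) x2; apply/eqP/matrixP=> a b.
rewrite mxE; have [->|/x1//] := eqVneq a ord0.
by apply: x2.
Qed.

Lemma semi_ext_into (tau : {rmorphism k -> k}) phi (i : 'I_2)
    (W : {vspace 'M[k]_(2, Q)}) :
  (forall j, phi i.+1 j \in W) -> maps_into (semi_ext tau phi) (bspan i.+1) W.
Proof.
move=> phiW x /bspanP x0; apply: memv_suml => a _; apply: memv_suml => b _.
have [->|ai] := eqVneq a i; first exact/memvZ/phiW.
by rewrite (x0 a b ai) rmorph0 scale0r mem0v.
Qed.

Definition swaps (phi : nat -> nat -> 'M[k]_(2, Q)) : Prop :=
  (forall j, phi 1 j \in bspan 2) /\ (forall j, phi 2 j \in bspan 1).

Definition graded_basis_mod phiF phiV (hF : swaps phiF) (hV : swaps phiV) :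
    graded_dieudonne chk :=
  GradedDieudonne (gd_mod := basis_mod phiF phiV) bspan_sum bspan_cap
    (semi_ext_into (frob chk) (i := ord0) hF.1) (semi_ext_into (frob chk) (i := ord_max) hF.2)
    (semi_ext_into (frobV chk) (i := ord0) hV.1) (semi_ext_into (frobV chk) (i := ord_max) hV.2).

End BasisModules.

Section StandardModules.
Variables (p : nat) (k : closedFieldType) (chk : p \in [pchar k]).
Local Open Scope nat_scope.

Definition M_F (Q u v i j : nat) : 'M[k]_(2, Q) :=
  if i == 1 then
    if (j == u) || (j == v) then 0%R
    else if j <= u - 1 then bvec k Q 2 j
    else if j <= v - 1 then bvec k Q 2 (j - 1)
    else bvec k Q 2 (j - 2)
  else
    if j == Q - v + 1 then bvec k Q 1 1
    else if j == Q - u + 1 then bvec k Q 1 2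
    else 0%R.

Definition M_V (Q u v i j : nat) : 'M[k]_(2, Q) :=
  if i == 1 then
    if (j == 1) || (j == 2) then 0%R
    else if j <= Q - v + 2 then bvec k Q 2 (j - 2)
    else if j <= Q - u + 1 then bvec k Q 2 (j - 1)
    else bvec k Q 2 j
  else
    if j == Q - 1 then bvec k Q 1 u
    else if j == Q then bvec k Q 1 v
    else 0%R.

Fact M_F_swaps Q u v : swaps (M_F Q u v).
Proof. by split=> j; rewrite /M_F /=; do ?case: ifP => _; rewrite ?mem0v ?bvec_in. Qed.

Fact M_V_swaps Q u v : swaps (M_V Q u v).
Proof. by split=> j; rewrite /M_V /=; do ?case: ifP => _; rewrite ?mem0v ?bvec_in. Qed.

Definition M_mod (Q u v : nat) : graded_dieudonne chk :=
  graded_basis_mod chk (M_F_swaps Q u v) (M_V_swaps Q u v).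

(* f_i is bvec k 1 i 1; F and V take the same values on the basis. *)
Definition N_FV (i j : nat) : 'M[k]_(2, 1) :=
  if i == 1 then bvec k 1 2 1 else 0%R.

Fact N_FV_swaps : swaps N_FV.
Proof. by split=> j; rewrite /N_FV /= ?mem0v ?bvec_in. Qed.

Definition N_mod : graded_dieudonne chk :=
  graded_basis_mod chk N_FV_swaps N_FV_swaps.

End StandardModules.

Section DirectSum.
Variables (p : nat) (k : closedFieldType) (chk : p \in [pchar k]).
Variables A B : graded_dieudonne chk.

Definition dsum_map (f : A -> A) (g : B -> B) (x : A * B) : A * B :=
  (f x.1, g x.2).

Fact dsum_map_semilinear (tau : k -> k) f g :
  semilinear tau f -> semilinear tau g -> semilinear tau (dsum_map f g).
Proof. by move=> hf hg a x y; rewrite /dsum_map /= hf hg. Qed.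

Definition dsum_mod : dieudonne chk :=
  Dieudonne
    (dsum_map_semilinear (@dmF_semilinear _ _ _ A) (@dmF_semilinear _ _ _ B))
    (dsum_map_semilinear (@dmV_semilinear _ _ _ A) (@dmV_semilinear _ _ _ B)).

Definition dsum_vspace (U : {vspace A}) (W : {vspace B}) : {vspace (A * B)%type} :=
  (linfun fst @^-1: U :&: linfun snd @^-1: W)%VS.

Lemma mem_dsum_vspace U W (x : A * B) :
  (x \in dsum_vspace U W) = (x.1 \in U) && (x.2 \in W).
Proof. by rewrite memv_cap -!memv_preim !lfunE. Qed.

Fact dsum_sum :
  (dsum_vspace (gd1 A) (gd1 B) + dsum_vspace (gd2 A) (gd2 B) = fullv)%VS.
Proof.
apply/eqP; rewrite eqEsubv subvf; apply/subvP=> -[a b] _.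
have /memv_addP[a1 a1P [a2 a2P ->]] : a \in (gd1 A + gd2 A)%VS by rewrite gd_sum memvf.
have /memv_addP[b1 b1P [b2 b2P ->]] : b \in (gd1 B + gd2 B)%VS by rewrite gd_sum memvf.
rewrite (_ : (a1 + a2, b1 + b2) = (a1, b1) + (a2, b2)) //.
by apply: memv_add; rewrite mem_dsum_vspace /= ?a1P ?a2P ?b1P ?b2P.
Qed.

Fact dsum_cap :
  (dsum_vspace (gd1 A) (gd1 B) :&: dsum_vspace (gd2 A) (gd2 B) = 0)%VS.
Proof.
apply/eqP; rewrite -subv0; apply/subvP=> -[a b].
rewrite memv_cap !mem_dsum_vspace memv0 /= => /andP[/andP[a1 b1] /andP[a2 b2]].
have : a \in (gd1 A :&: gd2 A)%VS by rewrite memv_cap a1.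
have : b \in (gd1 B :&: gd2 B)%VS by rewrite memv_cap b1.
by rewrite !gd_cap !memv0 => /eqP-> /eqP->.
Qed.

Fact dsum_into f g (U U' : {vspace A}) (W W' : {vspace B}) :
  maps_into f U U' -> maps_into g W W' ->
  maps_into (dsum_map f g) (dsum_vspace U W) (dsum_vspace U' W').
Proof.
move=> hf hg x; rewrite !mem_dsum_vspace /= => /andP[xU xW].
by rewrite hf // hg.
Qed.

Definition dsum : graded_dieudonne chk :=
  GradedDieudonne (gd_mod := dsum_mod) dsum_sum dsum_cap
    (dsum_into (@gdF1 _ _ _ A) (@gdF1 _ _ _ B))
    (dsum_into (@gdF2 _ _ _ A) (@gdF2 _ _ _ B))
    (dsum_into (@gdV1 _ _ _ A) (@gdV1 _ _ _ B))
    (dsum_into (@gdV2 _ _ _ A) (@gdV2 _ _ _ B)).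

End DirectSum.

Section DirectPower.
Variables (p : nat) (k : closedFieldType) (chk : p \in [pchar k]).
Variables (A : graded_dieudonne chk) (n : nat).

Definition dpow_map (f : A -> A) (x : {ffun 'I_n -> A}) : {ffun 'I_n -> A} :=
  [ffun i => f (x i)].

Fact dpow_map_semilinear (tau : k -> k) f :
  semilinear tau f -> semilinear tau (dpow_map f).
Proof. by move=> hf a x y; apply/ffunP=> i; rewrite !ffunE hf. Qed.

Definition dpow_mod : dieudonne chk :=
  Dieudonne (dpow_map_semilinear (@dmF_semilinear _ _ _ A))
            (dpow_map_semilinear (@dmV_semilinear _ _ _ A)).

Definition dpow_proj (i : 'I_n) (x : {ffun 'I_n -> A}) : A := x i.

Fact dpow_proj_is_linear i : linear (dpow_proj i).
Proof. by move=> a x y; rewrite /dpow_proj !ffunE. Qed.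

HB.instance Definition _ i :=
  GRing.isLinear.Build k {ffun 'I_n -> A} A _ (dpow_proj i)
    (dpow_proj_is_linear i).

Definition dpow_vspace (U : {vspace A}) : {vspace {ffun 'I_n -> A}} :=
  (\bigcap_(i < n) (linfun (dpow_proj i) @^-1: U))%VS.

Lemma mem_dpow_vspace (U : {vspace A}) (x : {ffun 'I_n -> A}) :
  reflect (forall i, x i \in U) (x \in dpow_vspace U).
Proof.
apply: (iffP idP) => [xU i|xU].
  move: xU; rewrite /dpow_vspace (bigD1 i) //= memv_cap => /andP[+ _].
  by rewrite -memv_preim lfunE.
rewrite /dpow_vspace; elim/big_ind: _ => [|V W xV xW|i _]; first exact: memvf.
  by rewrite memv_cap xV.
by rewrite -memv_preim lfunE; exact: xU.
Qed.

Fact dpow_sum : (dpow_vspace (gd1 A) + dpow_vspace (gd2 A) = fullv)%VS.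
Proof.
apply/eqP; rewrite eqEsubv subvf; apply/subvP=> x _.
pose q i := addv_pi1 (gd1 A) (gd2 A) (x i).
pose r i := addv_pi2 (gd1 A) (gd2 A) (x i).
have -> : x = [ffun i => q i] + [ffun i => r i].
  apply/ffunP=> i; rewrite !ffunE addv_pi1_pi2 //.
  by rewrite gd_sum memvf.
apply: memv_add; apply/mem_dpow_vspace=> i; rewrite ffunE.
  exact: memv_pi1.
exact: memv_pi2.
Qed.

Fact dpow_cap : (dpow_vspace (gd1 A) :&: dpow_vspace (gd2 A) = 0)%VS.
Proof.
apply/eqP; rewrite -subv0; apply/subvP=> x; rewrite memv_cap memv0.
case/andP=> /mem_dpow_vspace x1 /mem_dpow_vspace x2; apply/eqP/ffunP=> i.
have : x i \in (gd1 A :&: gd2 A)%VS by rewrite memv_cap x1 x2.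
by rewrite gd_cap memv0 ffunE => /eqP.
Qed.

Fact dpow_into f (U W : {vspace A}) :
  maps_into f U W -> maps_into (dpow_map f) (dpow_vspace U) (dpow_vspace W).
Proof.
move=> hf x /mem_dpow_vspace xU; apply/mem_dpow_vspace=> i.
by rewrite ffunE; apply: hf.
Qed.

Definition dpow : graded_dieudonne chk :=
  GradedDieudonne (gd_mod := dpow_mod) dpow_sum dpow_cap
    (dpow_into (@gdF1 _ _ _ A)) (dpow_into (@gdF2 _ _ _ A))
    (dpow_into (@gdV1 _ _ _ A)) (dpow_into (@gdV2 _ _ _ A)).

End DirectPower.

Definition second_smallest (s : seq nat) : nat := nth 0%N (sort leq s) 1.

(* Main.v *)
Require Import Defs.
From HB Require Import structures.
From mathcomp Require Import all_boot all_order all_algebra all_fingroup zify.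

Set Implicit Arguments.
Unset Strict Implicit.
Unset Printing Implicit Defensive.

Import GRing.Theory.
Local Open Scope ring_scope.

(* [L] has a homogeneous basis, indexed by [z : bool * 'I_d] (grade and
   position), and a permutation [pi] of the indices such that each [z] is of
   exactly one of two types: either [F e_z = e_(pi z)] and [V e_(pi z) = 0], or
   [F e_z = 0] and [V e_(pi z) = e_z]; the latter is recorded by [dl z = true].
   The basis is obtained from that of [M] by inserting the copies of [N] after
   [e_(1,r_2)] in degree 1, and at the matching place in degree 2; the
   inequalities defining [r_2] are exactly what makes [F] and [V] act on it by
   the formulas of [M^[Q+n]_(y,s)].

   Reading the types of [pi^-1 z], [pi^-2 z], ... gives a word, and the spans of
   the basis vectors with word below a given bound belong to every final
   filtration [W]: they arise from [0] and [L] by applying [F] and [V^-1].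
   Words are periodic, so basis vectors with the same long word have the same
   type; hence between two consecutive such spans [F] is either zero or
   injective, and [eta_1] does not depend on [W].  For existence, the words
   (together with the [pi]-orbit) order the basis up to ties between one vector
   of degree 1 and one of degree 2, and such ties are resolved by the sum of
   the two vectors. *)

(** * Words of a permutation *)

Section Words.
Variables (S : finType) (pi : {perm S}) (dl : pred S).
Local Open Scope nat_scope.

(* The types of [pi^-1 z], ..., [pi^-s z] as binary digits, the first one being
   the most significant. *)
Fixpoint wkey (s : nat) (z : S) : nat :=
  if s is s'.+1 then dl (pi^-1%g z) * 2 ^ s' + wkey s' (pi^-1%g z) else 0.

Lemma wkey_lt s z : wkey s z < 2 ^ s.
Proof.
elim: s z => [//|s IH] z /=; have := IH (pi^-1%g z); rewrite expnS.
by case: (dl _); lia.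
Qed.

Lemma wkeyS_last s z : wkey s.+1 z = (wkey s z).*2 + dl ((pi ^- s.+1)%g z).
Proof.
elim: s z => [|s IH] z; first by rewrite /= expg1 muln1 addn0.
have -> : wkey s.+2 z =
  dl (pi^-1%g z) * 2 ^ s.+1 + wkey s.+1 (pi^-1%g z) by [].
rewrite IH /= expnS -permM -expgVn -expgS expgVn.
by rewrite doubleD addnA mulnCA mul2n.
Qed.

Definition wkey_full (z : S) : nat := wkey #[pi]%g z.

(** The word of length [#[pi] + 1] of [pi z] is read from both ends: dropping its first digit leaves
    the word of [z], dropping its last leaves that of [pi z], and both dropped digits are the type
    of [z]. So [pi] rotates words cyclically. *)
Lemma wkey_full_rot z :
  (wkey_full (pi z)).*2 + dl z = dl z * 2 ^ #[pi]%g + wkey_full z.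
Proof.
have -> : dl z * 2 ^ #[pi]%g + wkey_full z = wkey #[pi]%g.+1 (pi z).
  by rewrite /= permK.
by rewrite wkeyS_last expgS expg_order mulg1 permK.
Qed.

Lemma wkey_full_odd z : odd (wkey_full z) = dl z.
Proof.
have /(congr1 odd) := wkey_full_rot z.
rewrite !oddD odd_double oddM oddX -leqn0 leqNgt order_gt0 /= andbF /=.
by rewrite oddb.
Qed.

Lemma wkey_full_mono z w : dl z = dl w ->
  (wkey_full (pi z) <= wkey_full (pi w)) = (wkey_full z <= wkey_full w).
Proof. by have := wkey_full_rot z; have := wkey_full_rot w => + + e; rewrite e; lia. Qed.

Lemma wkey_full_lt z w : ~~ dl z -> dl w -> wkey_full (pi z) < wkey_full (pi w).
Proof.
move=> /negPf zF wV; have := wkey_full_rot z; have := wkey_full_rot w.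
(* Rotation puts the types, 0 and 1, in front; strictness also uses that [wkey_full w] is odd, hence
   positive. *)
have := wkey_full_odd w; rewrite zF wV; have := wkey_lt #[pi]%g z.
rewrite -/(wkey_full z); case: (wkey_full w) => [|j]; first by [].
by lia.
Qed.

Definition orb_id (z : S) : nat := index (porbit pi z) (enum (porbits pi)).

Lemma orb_id_lt z : orb_id z < #|porbits pi|.
Proof. by rewrite cardE index_mem mem_enum imset_f. Qed.

Lemma orb_id_pi z : orb_id (pi z) = orb_id z.
Proof.
congr index; apply/eqP; rewrite eq_porbit_mem.
by have := mem_porbit pi 1 z; rewrite expg1.
Qed.

Lemma orb_idP z w : orb_id z = orb_id w -> exists i, w = (pi ^+ i)%g z.
Proof.
move=> e; have /porbitP [i ->] : w \in porbit pi z; last by exists i.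
rewrite -eq_porbit_mem; apply/eqP; symmetry.
rewrite -(nth_index set0 (s := enum (porbits pi)) (x := porbit pi z)) ?mem_enum ?imset_f //.
rewrite -/(orb_id z) e nth_index //; by rewrite mem_enum imset_f.
Qed.

(* Words of finite length do not separate points; the orbit is a
   [pi]-invariant tie-breaker. *)
Definition okey (z : S) : nat := wkey_full z * #|porbits pi| + orb_id z.

Lemma okey_le z w : (okey z <= okey w) =
  (wkey_full z < wkey_full w) ||
  ((wkey_full z == wkey_full w) && (orb_id z <= orb_id w)).
Proof.
rewrite /okey; have hz := orb_id_lt z; have hw := orb_id_lt w.
have [lt|lt|->] := ltngtP (wkey_full z) (wkey_full w); last by rewrite leq_add2l.
  have: (wkey_full z).+1 * #|porbits pi| <= wkey_full w * #|porbits pi|.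
    by rewrite leq_mul2r lt orbT.
  by rewrite mulSn; lia.
have: (wkey_full w).+1 * #|porbits pi| <= wkey_full z * #|porbits pi|.
  by rewrite leq_mul2r lt orbT.
by rewrite mulSn; lia.
Qed.

Lemma okey_eq z w : okey z = okey w ->
  wkey_full z = wkey_full w /\ orb_id z = orb_id w.
Proof.
move=> e; have := okey_le z w; have := okey_le w z.
by rewrite e leqnn; lia.
Qed.

Lemma okey_dl z w : okey z = okey w -> dl z = dl w.
Proof. by case/okey_eq => e _; rewrite -!wkey_full_odd e. Qed.

Lemma okey_mono z w : dl z = dl w ->
  (okey (pi z) <= okey (pi w)) = (okey z <= okey w).
Proof.
move=> e; rewrite !okey_le !orb_id_pi ltnNge eqn_leq !wkey_full_mono //.
by rewrite -ltnNge -eqn_leq.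
Qed.

Lemma okey_lt z w : ~~ dl z -> dl w -> okey (pi z) < okey (pi w).
Proof.
move=> hz hw; rewrite ltnNge okey_le negb_or -leqNgt.
have := wkey_full_lt hz hw; lia.
Qed.

End Words.

(** * Words and positions within one grade *)

Section Graded.
Variables (d : nat) (pi : {perm bool * 'I_d}) (dl : pred (bool * 'I_d)).
Local Open Scope nat_scope.
Local Notation S := (bool * 'I_d)%type.
Hypothesis pi_grade : forall z : S, (pi z).1 = ~~ z.1.
Hypothesis pi_mono : forall z w : S, z.1 = w.1 -> dl z = dl w ->
  z.2 < w.2 -> (pi z).2 < (pi w).2.
Hypothesis pi_FV : forall z w : S, z.1 = w.1 -> ~~ dl z -> dl w ->
  (pi z).2 < (pi w).2.

(** [pi_FV] makes the leading digit monotone in the position; when leading digits agree, [pi_mono]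
    shows that [pi^-1] keeps the order of positions, and induction handles the remaining digits. *)
Lemma wkey_graded s (z w : S) : z.1 = w.1 -> z.2 <= w.2 ->
  wkey pi dl s z <= wkey pi dl s w.
Proof.
elim: s z w => [//|s IH] z w g le /=.
set z' := pi^-1%g z; set w' := pi^-1%g w.
have g' : z'.1 = w'.1.
  by apply: negb_inj; rewrite -!pi_grade !permKV.
have [zV|zF] := boolP (dl z'); have [wV|wF] := boolP (dl w').
- rewrite leq_add2l; apply: IH => //; rewrite leqNgt; apply/negP => lt.
  by have := pi_mono (esym g') (etrans wV (esym zV)) lt; rewrite !permKV ltnNge le.
- by have := pi_FV (esym g') wF zV; rewrite !permKV ltnNge le.
- by rewrite mul0n mul1n (leq_trans (ltnW (wkey_lt pi dl s z'))) ?leq_addr.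
rewrite leq_add2l; apply: IH => //; rewrite leqNgt; apply/negP => lt.
have e : dl w' = dl z' by rewrite (negPf zF) (negPf wF).
by have := pi_mono (esym g') e lt; rewrite !permKV ltnNge le.
Qed.

Lemma wkey_full_iter (z w : S) i : wkey_full pi dl z = wkey_full pi dl w ->
  wkey_full pi dl ((pi ^+ i)%g z) = wkey_full pi dl ((pi ^+ i)%g w).
Proof.
move=> e; elim: i => [|i IH]; first by rewrite expg0 !perm1.
have e' : dl ((pi ^+ i)%g w) = dl ((pi ^+ i)%g z).
  by rewrite -!(wkey_full_odd pi) IH.
by apply/eqP; rewrite !expgSr !permM eqn_leq !wkey_full_mono // IH leqnn.
Qed.

Lemma graded_iter (z w : S) i : z.1 = w.1 -> wkey_full pi dl z = wkey_full pi dl w ->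
  z.2 < w.2 -> ((pi ^+ i)%g z).1 = ((pi ^+ i)%g w).1 /\
  ((pi ^+ i)%g z).2 < ((pi ^+ i)%g w).2.
Proof.
move=> g e lt; elim: i => [|i [IHg IH]]; first by rewrite expg0 !perm1.
rewrite !expgSr !permM !pi_grade IHg; split=> //; apply: pi_mono => //.
by rewrite -!(wkey_full_odd pi) (wkey_full_iter i e).
Qed.

(* If [pi ^+ i] moved a point within its grade without changing its word, it
   would move it ever further in the same direction. *)
Lemma word_orbit_lt (z w : S) : z.1 = w.1 -> wkey_full pi dl z = wkey_full pi dl w ->
  orb_id pi z = orb_id pi w -> ~~ (z.2 < w.2).
Proof.
move=> g e /orb_idP [i wE]; apply/negP => lt.
have step j : ((pi ^+ (i * j))%g z).2 < ((pi ^+ (i * j.+1))%g z).2.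
  by rewrite mulnS expgD permM -wE; have [] := graded_iter (i * j) g e lt.
have grow j : j <= ((pi ^+ (i * j))%g z).2.
  by elim: j => // j IH; apply: leq_ltn_trans IH (step j).
by have := leq_ltn_trans (grow d) (ltn_ord _); rewrite ltnn.
Qed.

(** By [word_orbit_lt] neither position exceeds the other. Thus a tie of [okey] involves at most one
    index of each grade. *)
Lemma okey_graded_inj (z w : S) : z.1 = w.1 -> okey pi dl z = okey pi dl w -> z = w.
Proof.
move=> g /okey_eq [e o].
have := word_orbit_lt g e o; have := word_orbit_lt (esym g) (esym e) (esym o).
case: z w g {e o} => [a i] [b j] /= -> h1 h2; congr pair; apply: val_inj.
by apply/eqP; rewrite eqn_leq leqNgt h1 leqNgt h2.
Qed.

End Graded.

(** * Coordinate subspaces *)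

Section Coordinates.
Variables (k : fieldType) (L : vectType k) (S : finType) (E : S -> L).
Hypothesis E_basis : basis_of fullv (codom E).

Local Notation crd z x := (coord (codom_tuple E) (enum_rank z) x).

Lemma nth_codom_rank z : (codom_tuple E)`_(enum_rank z) = E z.
Proof. by rewrite /= (nth_image 0 E) enum_rankK. Qed.

Lemma crd_basis z w : crd z (E w) = (z == w)%:R.
Proof.
rewrite -nth_codom_rank coord_free ?(basis_free E_basis) //.
by rewrite (inj_eq enum_rank_inj) eq_sym.
Qed.

Lemma crd_sum x : x = \sum_z crd z x *: E z.
Proof.
rewrite {1}(coord_basis (X := codom_tuple E) E_basis (memvf x)).
rewrite (reindex enum_rank) /=; last exact/onW_bij/enum_rank_bij.
by apply: eq_bigr => z _; rewrite -[in RHS]nth_codom_rank.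
Qed.

Lemma crd_comb (f : S -> k) z : crd z (\sum_w f w *: E w) = f z.
Proof.
rewrite linear_sum (bigD1 z) //= big1 => [|w wz].
  by rewrite linearZ /= crd_basis eqxx mulr1 addr0.
by rewrite linearZ /= crd_basis eq_sym (negPf wz) mulr0.
Qed.

Lemma crd_inj x y : (forall z, crd z x = crd z y) -> x = y.
Proof. by move=> e; rewrite (crd_sum x) (crd_sum y); apply: eq_bigr => z _; rewrite e. Qed.

Definition cspan (A : {set S}) : {vspace L} := <<[seq E z | z in A]>>%VS.

Lemma mem_cspan (A : {set S}) x :
  reflect (forall z, z \notin A -> crd z x = 0) (x \in cspan A).
Proof.
apply: (iffP idP) => [xA z zA|x0].
  move: xA; rewrite /cspan span_def big_map big_enum => /memv_sumP [f fA ->].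
  rewrite linear_sum big1 // => w wA.
  have /vlineP [c ->] := fA w wA.
  rewrite linearZ /= crd_basis; case: eqP => [zw|_]; last by rewrite mulr0.
  by rewrite zw wA in zA.
rewrite (crd_sum x); apply: memv_suml => z _.
have [zA|/x0->] := boolP (z \in A); last by rewrite scale0r mem0v.
by apply/memvZ/memv_span/image_f.
Qed.

Lemma cspanS (A B : {set S}) : A \subset B -> (cspan A <= cspan B)%VS.
Proof.
move=> /subsetP AB; apply/subvP => x /mem_cspan xA; apply/mem_cspan => z zB.
by apply: xA; apply: contra zB; exact: AB.
Qed.

Lemma cspanT : cspan setT = fullv.
Proof.
by apply/eqP; rewrite eqEsubv subvf; apply/subvP => x _; apply/mem_cspan => z; rewrite inE.
Qed.

Lemma cspan0 : cspan set0 = 0%VS.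
Proof.
apply/eqP; rewrite -subv0; apply/subvP => x /mem_cspan x0; rewrite memv0.
by apply/eqP/crd_inj => z; rewrite x0 ?inE // linear0.
Qed.

Lemma cspanI (A B : {set S}) : (cspan A :&: cspan B)%VS = cspan (A :&: B).
Proof.
apply/vspaceP => x; rewrite memv_cap; apply/andP/idP => [[/mem_cspan xA /mem_cspan xB]|xAB].
  by apply/mem_cspan => z; rewrite inE negb_and => /orP [/xA|/xB].
by split; [apply: subvP xAB | apply: subvP xAB]; rewrite cspanS ?subsetIl ?subsetIr.
Qed.

Lemma dim_basis_family : \dim {:L} = #|S|.
Proof. by rewrite -(size_basis (X := codom_tuple E) E_basis). Qed.

(** The spans of [A] and of its complement have at most the expected dimensions and together fill
    [L], so both bounds are equalities. *)
Lemma dim_cspan (A : {set S}) : \dim (cspan A) = #|A|.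
Proof.
have le B : (\dim (cspan B) <= #|B|)%N.
  by apply: leq_trans (dim_span _) _; rewrite size_map -cardE.
have := dimv_sum_cap (cspan A) (cspan (~: A)).
rewrite cspanI setICr cspan0 dimv0 addn0.
have -> : (cspan A + cspan (~: A) = fullv)%VS.
  apply/eqP; rewrite eqEsubv subvf; apply/subvP => x _; rewrite (crd_sum x).
  apply: memv_suml => z _; apply: memvZ.
  have [zA|zA] := boolP (z \in A).
    by apply: subvP (addvSl _ _) _ _; apply/memv_span/image_f.
  by apply: subvP (addvSr _ _) _ _; apply/memv_span/image_f; rewrite inE.
rewrite dim_basis_family -(cardsC A) => e; apply/eqP; rewrite eqn_leq le /=.
by rewrite -(leq_add2r #|~: A|) e leq_add2l le.
Qed.

Lemma crd_sum_set (B : {set S}) z : crd z (\sum_(w in B) E w) = (z \in B)%:R.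
Proof.
rewrite -(crd_comb (fun w => (w \in B)%:R) z) big_mkcond /=; congr (coord _ _ _).
by apply: eq_bigr => w _; case: (w \in B); rewrite ?scale1r ?scale0r.
Qed.

(** For a two-element [B] disjoint from [A], this lies strictly between [cspan A] and
    [cspan (A :|: B)]. *)
Definition cspan_line (A B : {set S}) : {vspace L} :=
  (cspan A + <[\sum_(z in B) E z]>)%VS.

Lemma mem_cspan_line (A B : {set S}) x :
  (x \in cspan_line A B) <->
  exists c, forall z, z \notin A -> crd z x = if z \in B then c else 0.
Proof.
split=> [/memv_addP [y /mem_cspan yA [_ /vlineP [c ->] ->]]|[c xc]].
  exists c => z /yA; rewrite linearD linearZ /= crd_sum_set => ->; rewrite add0r.
  by case: (z \in B); rewrite ?mulr1 ?mulr0.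
rewrite -[x](subrK (c *: \sum_(z in B) E z)); apply: memv_add.
  apply/mem_cspan => z /xc; rewrite linearB linearZ /= crd_sum_set => ->.
  by case: (z \in B); rewrite ?mulr1 ?mulr0 subrr.
by apply/memvZ/memv_line.
Qed.

End Coordinates.

Lemma semilinear_sum (k : fieldType) (tau : {rmorphism k -> k})
    (L L' : vectType k) (f : L -> L') (I : finType) (a : I -> k) (x : I -> L) :
  Defs.semilinear tau f -> f (\sum_i a i *: x i) = \sum_i tau (a i) *: f (x i).
Proof.
move=> fl; elim/big_rec2: _ => [|i y z _ <-]; last exact: fl.
exact: semilinear0 fl.
Qed.

(** At the least [i] with [t <= f i], a step of at most one from a value below [t] cannot
    overshoot. *)
Lemma nat_ivt (f : nat -> nat) (N t : nat) :
    (f 0 <= t <= f N)%N -> (forall i, (i < N)%N -> (f i.+1 <= (f i).+1)%N) ->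
  exists2 i, (i <= N)%N & f i = t.
Proof.
case/andP=> f0 fN step; have ex : exists i, (t <= f i)%N by exists N.
case: (ex_minnP ex) => i ti imin; exists i; first exact: imin.
case: i ti imin => [|i] ti imin; first by lia.
have iN : (i < N)%N := imin N fN; have := step i iN.
by have := imin i; case: (leqP t (f i)) => [_ /(_ isT)|]; lia.
Qed.

(** By [nat_ivt] the chain meets every dimension, and members of equal dimension coincide because
    they are comparable, so repetitions do no harm. *)
Lemma flag_of_chain (k : fieldType) (L : vectType k) (G : nat -> {vspace L}) N :
    G 0 = 0%VS -> G N = fullv -> (forall i, (G i <= G i.+1)%VS) ->
    (forall i, (\dim (G i.+1) <= (\dim (G i)).+1)%N) ->
  exists W : 'I_(\dim {:L}).+1 -> {vspace L},
    [/\ forall j, \dim (W j) = j,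
        forall i j : 'I_(\dim {:L}).+1, (i <= j)%N -> (W i <= W j)%VS,
        forall j, exists i, W j = G i
      & forall i, exists j, W j = G i].
Proof.
move=> G0 GN Gmono Gstep.
have mono i j : (i <= j)%N -> (G i <= G j)%VS.
  move=> /subnK <-; elim: (j - i)%N => [|n IH]; first exact: subvv.
  exact: subv_trans IH (Gmono _).
have Geq i j : (\dim (G i) <= \dim (G j))%N -> (G i <= G j)%VS.
  case: (leqP i j) => [/mono // | /ltnW ji le].
  suff /eqP -> : G j == G i by [].
  by rewrite eqEdim mono.
have ex (j : 'I_(\dim {:L}).+1) : exists i, \dim (G i) == j.
  have [||i _ <-] := @nat_ivt (fun i => \dim (G i)) N j; last by exists i.
    by rewrite G0 dimv0 GN leq0n -ltnS; exact: ltn_ord.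
  by move=> i _; apply: Gstep.
pose W j := G (xchoose (ex j)); have dimW j : \dim (W j) = j := eqP (xchooseP (ex j)).
exists W; split=> //.
- by move=> i j ij; apply: Geq; rewrite -![G _]/(W _) !dimW.
- by move=> j; exists (xchoose (ex j)).
move=> i; have lt : (\dim (G i) < (\dim {:L}).+1)%N by rewrite ltnS dimvS ?subvf.
exists (Ordinal lt); have e := dimW (Ordinal lt).
by apply/eqP; rewrite eqEsubv !Geq // -![G (xchoose _)]/(W _) e.
Qed.

(** * Monomial Dieudonne modules *)

Section Monomial.
Variables (p : nat) (k : closedFieldType) (chk : p \in [pchar k]).
Variables (L : dieudonne chk) (S : finType) (E : S -> L).
Variables (pi : {perm S}) (dl : pred S).
Hypothesis E_basis : basis_of fullv (codom E).
Hypothesis FE : forall z, dmF (E z) = if dl z then 0 else E (pi z).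
Hypothesis VE : forall z, dmV (E (pi z)) = if dl z then E z else 0.

Local Notation crd z x := (coord (codom_tuple E) (enum_rank z) x).

Lemma crd_F z x : crd (pi z) (dmF x) = if dl z then 0 else frob chk (crd z x).
Proof.
rewrite {1}(crd_sum E_basis x) (semilinear_sum _ _ (@dmF_semilinear _ _ _ L)).
rewrite linear_sum (bigD1 z) //= big1 => [|w wz]; last first.
  rewrite linearZ /= FE; case: (dl w); first by rewrite linear0 mulr0.
  by rewrite (crd_basis E_basis) (inj_eq perm_inj) eq_sym (negPf wz) mulr0.
rewrite addr0 linearZ /= FE; case: (dl z); first by rewrite linear0 mulr0.
by rewrite (crd_basis E_basis) eqxx mulr1.
Qed.

Lemma crd_V z x : crd z (dmV x) = if dl z then frobV chk (crd (pi z) x) else 0.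
Proof.
rewrite {1}(crd_sum E_basis x) (semilinear_sum _ _ (@dmV_semilinear _ _ _ L)).
rewrite linear_sum (bigD1 (pi z)) //= big1 => [|w wz]; last first.
  rewrite linearZ /= -[w in dmV (E w)](permKV pi) VE.
  case: (dl _); last by rewrite linear0 mulr0.
  rewrite (crd_basis E_basis); case: eqP => [zw|_]; last by rewrite mulr0.
  by rewrite zw permKV eqxx in wz.
rewrite addr0 linearZ /= VE; case: (dl z); last by rewrite linear0 mulr0.
by rewrite (crd_basis E_basis) eqxx mulr1.
Qed.

(** Index sets for [F(cspan A)] and [V^-1(cspan A)]. The implication in [Vpre] accounts for the
    kernel of [V], spanned by the [E (pi z)] with [dl z = false]; [Vimg] carries the extra line
    along. *)
Definition Fimg (A : {set S}) : {set S} :=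
  [set z | ~~ dl (pi^-1%g z) && (pi^-1%g z \in A)].
Definition Vimg (A : {set S}) : {set S} :=
  [set z | dl (pi^-1%g z) && (pi^-1%g z \in A)].
Definition Vpre (A : {set S}) : {set S} :=
  [set z | dl (pi^-1%g z) ==> (pi^-1%g z \in A)].

Lemma F_cspan_line (A B : {set S}) y :
  (y \in cspan_line E (Fimg A) (Fimg B)) <->
  exists2 x, x \in cspan_line E A B & y = dmF x.
Proof.
split=> [/(mem_cspan_line E_basis) [c yc]|[x /(mem_cspan_line E_basis) [c xc] ->]].
  (* [F] forgets the coordinates with [dl z], so there the preimage may be chosen to agree with the
     constant [frobV c] on [B]. *)
  pose a z := if dl z then (if z \in B then frobV chk c else 0)
              else frobV chk (crd (pi z) y).
  exists (\sum_z a z *: E z).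
    apply/(mem_cspan_line E_basis); exists (frobV chk c) => z zA.
    rewrite (crd_comb E_basis) /a; case: ifP => // zF.
    rewrite yc ?inE permK zF //=; by case: (z \in B); rewrite ?rmorph0.
  apply: (crd_inj E_basis) => w; rewrite -[w](permKV pi); move: (_ w) => z.
  rewrite crd_F (crd_comb E_basis) /a; case: ifP => zF; last by rewrite zF frobVK.
  by rewrite yc !inE permK zF.
apply/(mem_cspan_line E_basis); exists (frob chk c) => w.
rewrite -[w](permKV pi); move: (_ w) => z.
rewrite !inE permK crd_F; case: ifP => //= zF /xc ->.
by case: (z \in B); rewrite ?rmorph0.
Qed.

(** [V x] vanishes at indices with [dl z = false], so outside [A] a set [B] of mixed type would
    force the constant on [B] to be zero. With a single type, either the constant is carried over by
    Frobenius, or [Vimg B] is empty. *)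
Lemma V_cspan_line (A B : {set S}) x :
  {in B &, forall z w, dl z = dl w} ->
  (x \in cspan_line E (Vpre A) (Vimg B)) <-> (dmV x \in cspan_line E A B).
Proof.
move=> dlB; split=> /(mem_cspan_line E_basis) [c xc]; apply/(mem_cspan_line E_basis).
  exists (if [exists z in B, ~~ dl z] then 0 else frobV chk c) => z zA.
  rewrite crd_V; case: ifP => zV; last first.
    case: ifP => // zB; case: ifP => // /negbT /exists_inPn /(_ z zB).
    by rewrite zV.
  rewrite xc ?inE permK zV //=; case: ifP => zB; last by rewrite rmorph0.
  case: ifP => // /exists_inP [w wB]; by rewrite -(dlB z w zB wB) zV.
exists (frob chk c) => w; rewrite -[w](permKV pi); move: (_ w) => z.
rewrite !inE permK negb_imply => /andP [zV zA].
have := xc z zA; rewrite crd_V zV /= => /(congr1 (frob chk)); rewrite frobVK => ->.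
by case: (z \in B); rewrite ?rmorph0.
Qed.

Lemma cspan_line0 (A : {set S}) : cspan_line E A set0 = cspan E A.
Proof.
by apply/eqP; rewrite /cspan_line big_set0 eqEsubv addvSl subv_add subvv -memvE mem0v.
Qed.

Lemma Fimg0 : Fimg set0 = set0.
Proof. by apply/setP => z; rewrite !inE andbF. Qed.

Lemma Vimg0 : Vimg set0 = set0.
Proof. by apply/setP => z; rewrite !inE andbF. Qed.

Lemma F_cspan (A : {set S}) y :
  (y \in cspan E (Fimg A)) <-> exists2 x, x \in cspan E A & y = dmF x.
Proof. by rewrite -!cspan_line0 -[X in cspan_line _ (Fimg _) X]Fimg0; apply: F_cspan_line. Qed.

Lemma V_cspan (A : {set S}) x :
  (x \in cspan E (Vpre A)) <-> (dmV x \in cspan E A).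
Proof.
rewrite -!cspan_line0 -[X in cspan_line _ (Vpre _) X]Vimg0; apply: V_cspan_line.
by move=> z w; rewrite inE.
Qed.

Lemma kerF_cspan : kerF L = cspan E [set z | dl z].
Proof.
apply/vspaceP => x; rewrite memv_kerF; apply/eqP/(mem_cspan E_basis) => [x0 z|xV].
  rewrite inE => /negPf zF; have := crd_F z x; rewrite x0 linear0 zF.
  by move/esym/eqP; rewrite fmorph_eq0 => /eqP.
apply: (crd_inj E_basis) => w; rewrite -[w](permKV pi); move: (_ w) => z.
rewrite linear0 crd_F; case: ifP => // zF.
by rewrite xV ?inE ?zF // rmorph0.
Qed.

(** * Existence of a final filtration from a weight compatible with [pi] *)

Section FinalFiltration.
Variable h : S -> nat.
Hypothesis h_mono : forall z w, dl z = dl w -> (h (pi z) <= h (pi w))%N = (h z <= h w)%N.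
Hypothesis h_FV : forall z w, ~~ dl z -> dl w -> (h (pi z) < h (pi w))%N.
Hypothesis h_dl : forall z w, h z = h w -> dl z = dl w.

Definition low (a : nat) : {set S} := [set z | (h z < a)%N].
(** The flag [b] says whether a line is adjoined to [cspan (low a)]; both cases are kept in one form
    because [F] or [V^-1] may erase the line. *)
Definition level (a : nat) (b : bool) : {set S} :=
  if b then [set z | h z == a] else set0.

Lemma low_of_closed (A : {set S}) :
  (forall z w, z \in A -> (h w <= h z)%N -> w \in A) -> exists a, A = low a.
Proof.
move=> closed; exists (\max_(z in A) (h z).+1); apply/setP => w; rewrite inE.
apply/idP/idP => [wA|]; first exact: leq_bigmax_cond.
apply: contraLR => wA; rewrite -leqNgt; apply/bigmax_leqP => z zA.
by rewrite ltnNge; apply: contra wA; exact: closed.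
Qed.

Lemma h_lt z w : dl z = dl w -> (h (pi z) < h (pi w))%N = (h z < h w)%N.
Proof. by move=> e; rewrite ltnNge h_mono // -ltnNge. Qed.

Lemma h_eq z w : dl z = dl w -> (h (pi z) == h (pi w)) = (h z == h w).
Proof. by move=> e; rewrite eqn_leq !h_mono // -eqn_leq. Qed.

(** If the level contains some [z0] not killed by [F], its image is the whole level of [pi z0],
    since [h_FV] keeps images of the other type strictly above. Otherwise the line dies and only a
    downward closed set remains. *)
Lemma Fimg_step a b : exists a' b',
  Fimg (low a) = low a' /\ Fimg (level a b) = level a' b'.
Proof.
have [z0 /andP [z0a z0F]|none] := pickP [pred z | (z \in level a b) && ~~ dl z].
  case: b z0a => /=; rewrite inE // => /eqP z0a.
  exists (h (pi z0)), true; split; apply/setP => w;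
    rewrite -[w](permKV pi); move: (_ w) => z; rewrite !inE permK -z0a.
    have [zV|zF] := boolP (dl z); last by rewrite h_lt // (negPf zF) (negPf z0F).
    by apply/esym/negbTE; rewrite -leqNgt ltnW ?h_FV.
  have [zV|zF] := boolP (dl z); last by rewrite h_eq // (negPf zF) (negPf z0F).
  by have := h_FV z0F zV; rewrite ltn_neqAle eq_sym => /andP [/negPf].
have [|a' ->] := @low_of_closed (Fimg (low a)).
  move=> z w; rewrite -[z](permKV pi) -[w](permKV pi); move: (_ z) (_ w) => z1 w1.
  rewrite !inE !permK => /andP [zF za] le.
  have [wV|wF] := boolP (dl w1); first by have := h_FV zF wV; rewrite ltnNge le.
  move: le; rewrite h_mono ?(negPf zF) ?(negPf wF) // => /leq_ltn_trans; exact.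
exists a', false; split=> //; apply/setP => w; rewrite !inE.
by have /= := none (pi^-1%g w); rewrite andbC.
Qed.

Lemma Vimg_step a b : exists a' b',
  Vpre (low a) = low a' /\ Vimg (level a b) = level a' b'.
Proof.
have [z0 /andP [z0a z0V]|none] := pickP [pred z | (z \in level a b) && dl z].
  case: b z0a => /=; rewrite inE // => /eqP z0a.
  exists (h (pi z0)), true; split; apply/setP => w;
    rewrite -[w](permKV pi); move: (_ w) => z; rewrite !inE permK -z0a.
    have [zV|zF] := boolP (dl z); first by rewrite h_lt // zV z0V.
    by rewrite h_FV.
  have [zV|zF] := boolP (dl z); first by rewrite h_eq // zV z0V.
  by have := h_FV zF z0V; rewrite ltn_neqAle => /andP [/negPf].
have [|a' ->] := @low_of_closed (Vpre (low a)).
  move=> z w; rewrite -[z](permKV pi) -[w](permKV pi); move: (_ z) (_ w) => z1 w1.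
  rewrite !inE !permK => /implyP za le; apply/implyP => wV.
  have [zV|zF] := boolP (dl z1); last by have := h_FV zF wV; rewrite ltnNge le.
  move: le; rewrite h_mono ?zV ?wV // => /leq_ltn_trans; apply; exact: za.
exists a', false; split=> //; apply/setP => w; rewrite !inE.
by have /= := none (pi^-1%g w); rewrite andbC.
Qed.

Hypothesis h_fiber : forall a, (#|level a true| <= 2)%N.

(* Half steps through the fibres of [h]: when a fibre has two elements, the
   line spanned by the sum of both is fixed by the return map of [F] and
   [V^-1], although it need not be graded. *)
Definition half_step (i : nat) : {vspace L} :=
  cspan_line E (low i./2) (level i./2 (odd i)).

Lemma half_step_even a : half_step a.*2 = cspan E (low a).
Proof. by rewrite /half_step odd_double doubleK cspan_line0. Qed.

Lemma low_succ a : low a.+1 = low a :|: level a true.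
Proof. by apply/setP => z; rewrite !inE ltnS leq_eqVlt orbC. Qed.

Lemma low_odd i : odd i -> half_step i = cspan_line E (low i./2) (level i./2 true).
Proof. by rewrite /half_step => ->. Qed.

Lemma half_stepS i : (half_step i <= half_step i.+1)%VS.
Proof.
have [oi|ei] := boolP (odd i); last first.
  have -> : i = (i./2).*2 by rewrite -[LHS]odd_double_half (negPf ei).
  rewrite half_step_even low_odd /= ?odd_double //.
  by rewrite uphalf_double addvSl.
have -> : i.+1 = (i./2.+1).*2 by rewrite -[in LHS](odd_double_half i) oi.
rewrite low_odd // half_step_even subv_add cspanS // low_succ ?subsetUl //=.
rewrite -memvE; apply: memv_suml => z zl; apply/memv_span/image_f.
by rewrite inE zl orbT.
Qed.

Lemma dim_half_stepS i : (\dim (half_step i.+1) <= (\dim (half_step i)).+1)%N.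
Proof.
have [oi|ei] := boolP (odd i); last first.
  have -> : i = (i./2).*2 by rewrite -[LHS]odd_double_half (negPf ei).
  rewrite half_step_even low_odd /= ?odd_double // uphalf_double.
  apply: leq_trans (dimv_add_leqif _ _).1 _; rewrite dim_vline -addn1 leq_add2l.
  by case: (_ != 0).
have -> : i.+1 = (i./2.+1).*2 by rewrite -[in LHS](odd_double_half i) oi.
rewrite (low_odd oi) half_step_even (dim_cspan E_basis) low_succ.
set a := i./2; have le : (cspan E (low a) <= cspan_line E (low a) (level a true))%VS.
  exact: addvSl.
apply: leq_trans (leq_card_setU _ _) _.
have [z0 z0a|l0] := pickP (mem (level a true)); last first.
  by rewrite (eq_card0 l0) addn0 -(dim_cspan E_basis) leqW // dimvS.
(* The level adds at most two dimensions, and for a nonempty level the half step already accounts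
   for one of them. *)
suff lt : (#|low a| < \dim (cspan_line E (low a) (level a true)))%N.
  by have := h_fiber a; lia.
rewrite -(dim_cspan E_basis) ltn_neqAle dimvS // andbT.
apply/negP => /eqP e.
have /vspaceP /(_ (\sum_(z in level a true) E z)) :
    cspan E (low a) = cspan_line E (low a) (level a true).
  by apply/eqP; rewrite eqEdim le e leqnn.
have -> : \sum_(z in level a true) E z \in cspan_line E (low a) (level a true).
  by apply: subvP (addvSr _ _) _ _; apply: memv_line.
move/(mem_cspan E_basis) => /(_ z0); move: z0a; rewrite !inE => /eqP z0a.
rewrite z0a ltnn => /(_ isT) /eqP; rewrite (crd_sum_set E_basis) inE z0a eqxx.
by rewrite oner_eq0.
Qed.

Lemma final_filtration_exists :
  exists W : 'I_(\dim {:L}).+1 -> {vspace L}, final_filtration W.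
Proof.
pose N := (\max_z (h z).+1).
have [||||W [dimW monoW Wstep stepW]] := @flag_of_chain _ L half_step N.*2.
- by rewrite (half_step_even 0) (_ : low 0 = set0) ?(cspan0 E_basis) //.
- rewrite half_step_even (_ : low N = setT) ?(cspanT E_basis) //.
  by apply/setP => z; rewrite !inE; apply: (leq_bigmax z).
- exact: half_stepS.
- exact: dim_half_stepS.
(* The half step of index [b + 2a] encodes the pair [(a, b)]. *)
have line_step a b : exists j, W j = cspan_line E (low a) (level a b).
  have [j e] := stepW (b + a.*2)%N; exists j; rewrite e.
  by rewrite /half_step oddD odd_double addbF oddb half_bit_double.
exists W; split=> // j; have [i ->] := Wstep j.
  have [a [b [eA eB]]] := Fimg_step i./2 (odd i).
  have [j' Wj'] := line_step a b; exists j' => y.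
  by rewrite Wj' -eA -eB F_cspan_line.
have [a [b [eA eB]]] := Vimg_step i./2 (odd i).
have [j' Wj'] := line_step a b; exists j' => x.
rewrite Wj' -eA -eB V_cspan_line // => z w.
by rewrite /level; case: ifP => _; rewrite !inE // => /eqP zi /eqP wi; apply: h_dl; rewrite zi.
Qed.

End FinalFiltration.
End Monomial.

(** Between [U] and [U'] the intersection with [K] is either constant or, by the modular law, grows
    exactly as fast as the space; either way only the dimension matters. *)
Lemma dim_cap_between (k : fieldType) (L : vectType k) (U U' K X Y : {vspace L}) :
    (U <= X <= U')%VS -> (U <= Y <= U')%VS -> \dim X = \dim Y ->
    (U' :&: K <= U)%VS || (U' <= U + K)%VS ->
  \dim (X :&: K) = \dim (Y :&: K).
Proof.
move=> UXU' UYU' eXY /orP [UK|UK].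
  suff capE Z : (U <= Z <= U')%VS -> (Z :&: K = U :&: K)%VS by rewrite !capE.
  case/andP=> UZ ZU'; apply/eqP; rewrite eqEsubv (capvS UZ (subvv K)) andbT subv_cap capvSr andbT.
  exact: subv_trans (capvS ZU' (subvv K)) UK.
suff dimE Z : (U <= Z <= U')%VS ->
    (\dim Z + \dim (U :&: K) = \dim U + \dim (Z :&: K))%N.
  by have := dimE _ UXU'; have := dimE _ UYU'; rewrite eXY => ->; lia.
case/andP=> UZ ZU'; have := dimv_sum_cap U (Z :&: K).
rewrite capvA (capv_idPl UZ) [(Z :&: K)%VS]capvC vspace_modl //.
by rewrite (capv_idPr (subv_trans ZU' UK)).
Qed.

(** * Independence of [eta1] from the final filtration, and the index of a graded monomial module *)

Section GradedMonomial.
Variables (p : nat) (k : closedFieldType) (chk : p \in [pchar k]).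
Variables (L : graded_dieudonne chk) (d : nat).
Local Notation S := (bool * 'I_d)%type.
Variables (E : S -> L) (pi : {perm S}) (dl : pred S).
Hypothesis E_basis : basis_of fullv (codom E).
Hypothesis FE : forall z, dmF (E z) = if dl z then 0 else E (pi z).
Hypothesis VE : forall z, dmV (E (pi z)) = if dl z then E z else 0.
Hypothesis E_grade : forall z : S, E z \in if z.1 then gd1 L else gd2 L.
Hypothesis pi_grade : forall z : S, (pi z).1 = ~~ z.1.
Hypothesis pi_mono : forall z w : S, z.1 = w.1 -> dl z = dl w ->
  (z.2 < w.2)%N -> ((pi z).2 < (pi w).2)%N.
Hypothesis pi_FV : forall z w : S, z.1 = w.1 -> ~~ dl z -> dl w ->
  ((pi z).2 < (pi w).2)%N.

Lemma gd1_cspan : gd1 L = cspan E [set z : S | z.1].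
Proof.
have sub (b : bool) x : x \in cspan E [set z : S | z.1 == b] ->
    x \in if b then gd1 L else gd2 L.
  rewrite /cspan span_def big_map big_enum; apply: subvP.
  by apply/subv_sumP => z; rewrite inE => /eqP <-; rewrite -memvE E_grade.
have e : [set z : S | z.1] = [set z : S | z.1 == true].
  by apply/setP => z; rewrite !inE eqb_id.
apply/vspaceP => x; apply/idP/idP => [x1|]; last by rewrite e => /sub.
have : x \in (cspan E [set z : S | z.1 == true] + cspan E [set z : S | z.1 == false])%VS.
  rewrite (crd_sum E_basis x); apply: memv_suml => z _; apply: memvZ.
  case zb: z.1; [apply: subvP (addvSl _ _) _ _ | apply: subvP (addvSr _ _) _ _];
    by apply/memv_span/image_f; rewrite inE zb.
case/memv_addP => y yT [y' /[dup] yF' /sub /= yF xE].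
suff y0 : y' = 0 by rewrite e xE y0 addr0.
apply/eqP; rewrite -memv0 -(gd_cap L) memv_cap yF andbT.
have -> : y' = x - y by rewrite xE addrC addKr.
by rewrite memvB // (sub true).
Qed.

(** Induction strips the leading digit. A bound [a <= 2 ^ s] selects only leading digit 0 and gives
    the [F]-image of the span for [a]; a larger bound gives [V^-1] of the span for [a - 2 ^ s].
    Empty words give only [0] and [L]. *)
Lemma canonical_member (W : 'I_(\dim {:L}).+1 -> {vspace L}) s a :
  final_filtration (L := L) W ->
  exists j, W j = cspan E [set z | (wkey pi dl s z < a)%N].
Proof.
case=> dimW _ WF WV; elim: s a => [|s IH] a.
  case: a => [|a].
    exists ord0; rewrite (_ : [set z | _] = set0); last by apply/setP => z; rewrite !inE.
    by rewrite (cspan0 E_basis); apply/eqP; rewrite -dimv_eq0 dimW.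
  exists ord_max; rewrite (_ : [set z | _] = setT); last by apply/setP => z; rewrite !inE.
  by rewrite (cspanT E_basis); apply/eqP; rewrite eqEdim subvf dimW /=.
have [le|gt] := leqP a (2 ^ s).
  have [j Wj] := IH a; have [i Wi] := WF j; exists i.
  apply/vspaceP => y; apply/idP/idP.
    rewrite Wi Wj => /(F_cspan E_basis FE); apply: subvP; apply: cspanS E_basis _ _ _.
    apply/subsetP => z; rewrite !inE /= => /andP [/negPf -> ].
    by rewrite mul0n.
  move=> yA; apply/Wi; rewrite Wj; apply/(F_cspan E_basis FE).
  apply: subvP yA; apply: cspanS E_basis _ _ _; apply/subsetP => z; rewrite !inE /=.
  case: (dl _) => //=; rewrite mul1n => /(leq_ltn_trans (leq_addr _ _)).
  by rewrite ltnNge le.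
have [j Wj] := IH (a - 2 ^ s)%N; have [i Wi] := WV j; exists i.
apply/vspaceP => y; apply/idP/idP.
  rewrite Wi Wj => /(V_cspan E_basis VE); apply: subvP; apply: cspanS E_basis _ _ _.
  apply/subsetP => z; rewrite !inE /=; case: (dl _) => /=; first by rewrite mul1n ltn_subRL.
  by rewrite mul0n add0n => _; apply: ltn_trans gt; apply: wkey_lt.
move=> yA; apply/Wi; rewrite Wj; apply/(V_cspan E_basis VE).
apply: subvP yA; apply: cspanS E_basis _ _ _; apply/subsetP => z; rewrite !inE /=.
by case: (dl _) => //=; rewrite mul1n ltn_subRL.
Qed.

Definition initial (t : nat) : {set S} := [set z : S | z.1 && (z.2 < t)%N].

Lemma card_initial t : (t <= d)%N -> #|initial t| = t.
Proof.
move=> td; have -> : initial t = (fun i => (true, widen_ord td i)) @: setT.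
  apply/setP => -[b i]; rewrite inE /=; apply/andP/imsetP => [[/= -> it]|[j _ [-> ->]]].
    by exists (Ordinal it); rewrite ?inE //; congr pair; apply: val_inj.
  by rewrite /= ltn_ord.
by rewrite card_imset ?cardsT ?card_ord // => i j [] /= e; apply: val_inj.
Qed.

(** [A] is an initial segment of the degree 1 indices, and initial segments of a total order are
    compared by cardinality. *)
Lemma initial_between (A : {set S}) t : (t <= d)%N ->
  (forall z, z \in A -> z.1) ->
  (forall z w : S, z \in A -> w.1 -> (w.2 <= z.2)%N -> w \in A) ->
  ((#|A| <= t)%N -> A \subset initial t) /\ ((t <= #|A|)%N -> initial t \subset A).
Proof.
move=> td A1 Adown; split=> le; apply/subsetP => z.
  move=> zA; rewrite inE A1 //= ltnNge; apply/negP => tz.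
  suff : (t < #|A|)%N by rewrite ltnNge le.
  rewrite -[X in (X <= _)%N](@card_initial t.+1); last exact: leq_ltn_trans tz (ltn_ord _).
  apply/subset_leq_card/subsetP => w; rewrite inE ltnS => /andP [w1 wt].
  by apply: Adown zA w1 (leq_trans wt tz).
rewrite inE => /andP [z1 zt]; apply/negPn/negP => zA.
suff : (#|A| < t)%N by rewrite ltnNge le.
apply: leq_ltn_trans zt; rewrite -(@card_initial z.2); last exact: ltnW.
apply/subset_leq_card/subsetP => w wA; rewrite inE A1 //= ltnNge.
by apply: contra zA => /(Adown _ _ wA z1).
Qed.

(** Rules out the default value of [flag1]: the dimension of [W j :&: gd1 L] climbs from 0 to [d] in
    steps of at most one. *)
Lemma flag1_dim (W : 'I_(\dim {:L}).+1 -> {vspace L}) t :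
    final_filtration (L := L) W -> (t <= d)%N ->
  exists2 j, flag1 (L := L) W t = (W j :&: gd1 L)%VS & \dim (W j :&: gd1 L) = t.
Proof.
case=> dimW monoW _ _ td; rewrite /flag1; case: pickP => [j /eqP <-|none]; first by exists j.
have W0 : W (inord 0) = 0%VS by apply/eqP; rewrite -dimv_eq0 dimW inordK.
have WT : W (inord (\dim {:L})) = fullv.
  by apply/eqP; rewrite eqEdim subvf dimW inordK ?leqnn.
have [||i _ e] := @nat_ivt (fun i => \dim (W (inord i) :&: gd1 L)) (\dim {:L}) t.
- rewrite /= W0 WT cap0v dimv0 capfv gd1_cspan (dim_cspan E_basis) /=.
  rewrite -[X in (X <= _)%N](card_initial td); apply/subset_leq_card/subsetP => z.
  by rewrite !inE => /andP [].
- move=> i iN; set U := gd1 L; set X := W (inord i); set X' := W (inord i.+1).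
  have XX' : (X <= X')%VS by apply: monoW; rewrite !inordK // ltnS ltnW.
  have := dimv_sum_cap (X' :&: U) X.
  have -> : (X' :&: U :&: X = X :&: U)%VS.
    by rewrite capvC capvA (capv_idPl XX').
  have : (\dim (X' :&: U + X) <= i.+1)%N.
    have <- : \dim X' = i.+1 by rewrite dimW inordK.
    by apply: dimvS; rewrite subv_add capvSl.
  have -> : \dim X = i by rewrite dimW inordK // ltnS ltnW.
  by lia.
by have := none (inord i); rewrite e eqxx.
Qed.

(** The member of dimension [t] and the span of [initial t] lie between the same two consecutive
    word spans, where [dim_cap_between] applies. *)
Lemma eta1_initial (W : 'I_(\dim {:L}).+1 -> {vspace L}) t :
    final_filtration (L := L) W -> (t <= d)%N ->
  eta1 (L := L) W t = #|initial t :&: [set z | dl z]|.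
Proof.
move=> Wfin td; have [dimW monoW _ _] := Wfin.
have [j Ej dimE] := flag1_dim Wfin td; rewrite /eta1 {}Ej.
rewrite -(dim_cspan E_basis) -(cspanI E_basis) -(kerF_cspan E_basis FE).
pose C a := [set z | (wkey_full pi dl z < a)%N].
have exC : exists a, (W j <= cspan E (C a.+1))%VS.
  exists (2 ^ #[pi]%g)%N; apply/subvP => x _; apply/(mem_cspan E_basis) => z.
  by rewrite inE ltnS ltnW ?wkey_lt.
case: (ex_minnP exC) => a WC amin.
have CW : (cspan E (C a) <= W j)%VS.
  case: a amin {WC} => [|a] amin.
    by rewrite (_ : C 0%N = set0) ?(cspan0 E_basis) ?sub0v //.
  (* The word span belongs to the flag, hence is comparable with [W j]; if it contained [W j],
     minimality would fail. *)
  have [j' Wj'] := canonical_member #[pi]%g a.+1 Wfin.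
  rewrite -[C a.+1]/[set z | (wkey pi dl #[pi]%g z < a.+1)%N] -Wj'.
  have [//|/ltnW /monoW] := leqP j' j; first exact: monoW.
  by rewrite Wj' => /amin; rewrite ltnn.
pose A b := [set z : S | z.1] :&: C b.
have Adown b : forall z w : S, z \in A b -> w.1 -> (w.2 <= z.2)%N -> w \in A b.
  move=> z w; rewrite !inE => /andP [z1 zb] w1 wz; rewrite w1 /=.
  by apply: leq_ltn_trans zb; apply: wkey_graded; rewrite ?z1 ?w1.
have A1 b : forall z : S, z \in A b -> z.1 by move=> z; rewrite !inE => /andP [].
have AE : (cspan E (A a) <= W j :&: gd1 L)%VS.
  by rewrite -(cspanI E_basis) -gd1_cspan capvC capvS.
have EA : (W j :&: gd1 L <= cspan E (A a.+1))%VS.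
  by rewrite -(cspanI E_basis) -gd1_cspan capvC capvS.
have [le _] := initial_between td (A1 a) (Adown a).
have [_ ge] := initial_between td (A1 a.+1) (Adown a.+1).
have cardA : (#|A a| <= t)%N by rewrite -(dim_cspan E_basis) -dimE dimvS.
have cardA' : (t <= #|A a.+1|)%N by rewrite -(dim_cspan E_basis) -dimE dimvS.
apply: (@dim_cap_between _ _ (cspan E (A a)) (cspan E (A a.+1))).
- by rewrite AE EA.
- by rewrite !(cspanS E_basis) ?le ?ge.
- by rewrite dimE (dim_cspan E_basis) card_initial.
rewrite (kerF_cspan E_basis FE) (cspanI E_basis).
(* All indices of the block have word exactly [a], whose last digit is their type. *)
have block z : z \in A a.+1 -> z \notin A a -> dl z = odd a.
  rewrite !inE => /andP [-> +] /=; rewrite ltnS -leqNgt => z1 z2.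
  rewrite -(wkey_full_odd pi); congr odd; apply/eqP.
  by rewrite eqn_leq z1 z2.
have [oa|ea] := boolP (odd a); [apply/orP; right | apply/orP; left].
  apply/subvP => x /(mem_cspan E_basis) xA; rewrite (crd_sum E_basis x).
  apply: memv_suml => z _.
  have [zA'|/xA->] := boolP (z \in A a.+1); last by rewrite scale0r mem0v.
  apply: memvZ; have [zA|zA] := boolP (z \in A a).
    by apply: subvP (addvSl _ _) _ _; apply/memv_span/image_f.
  apply: subvP (addvSr _ _) _ _; apply/memv_span/image_f.
  by rewrite inE (block z) ?oa.
apply: cspanS E_basis _ _ _; apply/subsetP => z /setIP [zA']; rewrite inE => zV.
by apply: contraLR zV => zA; rewrite (block z).
Qed.

Lemma EO_index_graded_monomial (c u v : nat) (cd : d = (c + 2)%N) :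
    (1 <= u)%N -> (u < v)%N -> (v <= d)%N ->
    (forall i : 'I_d, dl (true, i) = (i.+1 == u) || (i.+1 == v)) ->
  EO_index L c (gamma c u v).
Proof.
move=> u1 uv vd dl1.
have du : (u.-1 < d)%N by lia.
have dv : (v.-1 < d)%N by lia.
split.
- rewrite gd1_cspan (dim_cspan E_basis) (_ : [set z : S | z.1] = initial d) ?card_initial //.
  by apply/setP => -[b i]; rewrite !inE ltn_ord andbT.
- rewrite gd1_cspan (kerF_cspan E_basis FE) (cspanI E_basis) (dim_cspan E_basis).
  have -> : [set z : S | z.1] :&: [set z | dl z] =
      [set (true, Ordinal du); (true, Ordinal dv)].
    apply/setP => -[[] i]; rewrite !inE //= dl1 !xpair_eqE /= -!val_eqE /=.
    by congr (_ || _); lia.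
  by rewrite cards2 xpair_eqE /= -val_eqE /=; case: eqP => //; lia.
- apply: (@final_filtration_exists _ _ _ L _ E pi dl E_basis FE VE (okey pi dl)).
  + exact: okey_mono.
  + exact: okey_lt.
  + exact: okey_dl.
  (* A fibre of [okey] injects into the two grades. *)
  move=> a; rewrite -[2%N]card_bool.
  rewrite -(@card_in_imset _ _ fst); first exact: max_card.
  move=> z w; rewrite !inE => /eqP ea /eqP eb g.
  by apply: (okey_graded_inj pi_grade pi_mono g); rewrite ea eb.
move=> W Wfin; exists u, v; split; rewrite -?cd // => t /andP [t1 td].
have t1d : (t.-1 < d)%N by lia.
rewrite !eta1_initial //; last exact: ltnW.
(* Position [t.-1] stands for the index [t]; it is the only one added, so [eta1] jumps exactly when
   it has [dl]. *)
have -> : initial t :&: [set z | dl z] =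
    (if dl (true, Ordinal t1d) then [set (true, Ordinal t1d)] else set0)
    :|: (initial t.-1 :&: [set z | dl z]).
  apply/setP => -[b i]; rewrite !inE /=.
  have -> : (i < t)%N = (i == Ordinal t1d) || (i < t.-1)%N.
    by rewrite -val_eqE /=; lia.
  have [->|ni] := eqVneq i (Ordinal t1d).
    by case: b; case: ifP => h; rewrite ?inE ?xpair_eqE ?eqxx ?h ?andbF /=.
  by case: ifP; rewrite ?inE ?xpair_eqE ?(negPf ni) ?andbF /= ?andbA.
rewrite cardsU (_ : _ :&: (_ :&: _) = set0); last first.
  apply/setP => -[b i]; rewrite !inE; case: ifP; rewrite ?inE //= xpair_eqE.
  by case: (i =P _) => [->|_] /=; rewrite ?ltnn ?andbF.
rewrite cards0 subn0 -[X in (X < _)%N]add0n ltn_add2r dl1 /= prednK //.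
by case: ifP; rewrite ?cards1 ?cards0.
Qed.

End GradedMonomial.

(** * The standard module, and insertion of the copies of N *)

Section StandardPermutation.
Variables (d y s : nat).
Hypotheses (y1 : (1 <= y)%N) (ys : (y < s)%N) (sd : (s <= d)%N).
Local Open Scope nat_scope.

Definition std_type (b : bool) (j : nat) : bool :=
  if b then (j == y) || (j == s) else (j != d - s + 1) && (j != d - y + 1).

(** Reads the tables of [M^[d]_(y,s)]: the target of [F] where [F] is nonzero, and otherwise the
    index that [V] sends to [j]. *)
Definition std_next (b : bool) (j : nat) : nat :=
  if b then
    if j == y then d - 1 else if j == s then d
    else if j < y then j else if j < s then j - 1 else j - 2
  else
    if j == d - s + 1 then 1 else if j == d - y + 1 then 2
    else if j < d - s + 1 then j + 2 else if j < d - y + 1 then j + 1 else j.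

Lemma std_next_bounds b j : 1 <= j <= d -> 1 <= std_next b j <= d.
Proof. by move=> jd; rewrite /std_next; case: b; do !case: ifP => ?; lia. Qed.

Lemma std_next_mono b i j : 1 <= i <= d -> 1 <= j <= d ->
  std_type b i = std_type b j -> i < j -> std_next b i < std_next b j.
Proof.
by move=> id jd; rewrite /std_next /std_type; case: b => e ij; do !case: ifP => ?; lia.
Qed.

Lemma std_next_FV b i j : 1 <= i <= d -> 1 <= j <= d ->
  ~~ std_type b i -> std_type b j -> std_next b i < std_next b j.
Proof.
by move=> id jd; rewrite /std_next /std_type; case: b => e ij; do !case: ifP => ?; lia.
Qed.

Definition std_fun (z : bool * 'I_d) : bool * 'I_d :=
  (~~ z.1, insubd z.2 (std_next z.1 z.2.+1).-1).

Lemma std_funE z : (std_fun z).2.+1 = std_next z.1 z.2.+1.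
Proof.
have jd : 1 <= z.2.+1 <= d by rewrite ltn_ord.
have /andP [h0 hd] := std_next_bounds z.1 jd.
by rewrite /= val_insubd prednK // hd /= prednK.
Qed.

Definition std_dl (z : bool * 'I_d) : bool := std_type z.1 z.2.+1.

Lemma std_fun_mono z w : z.1 = w.1 -> std_dl z = std_dl w ->
  z.2 < w.2 -> (std_fun z).2 < (std_fun w).2.
Proof.
move=> g e lt; rewrite -ltnS !std_funE g; apply: std_next_mono; rewrite ?ltn_ord //.
by rewrite -{1}g.
Qed.

Lemma std_fun_FV z w : z.1 = w.1 -> ~~ std_dl z -> std_dl w ->
  (std_fun z).2 < (std_fun w).2.
Proof.
move=> g zF wV; rewrite -ltnS !std_funE g; apply: std_next_FV; rewrite ?ltn_ord //.
by rewrite -g.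
Qed.

(** Within a grade, images of indices of different type are strictly separated, and [std_fun] is
    strictly increasing on each type. *)
Lemma std_fun_inj : injective std_fun.
Proof.
move=> [a i] [b j] e; have ab : a = b by apply: negb_inj; case: e.
rewrite {}ab in e *; congr pair; have e2 := congr1 (fun z => val z.2) e.
have FV := std_fun_FV (erefl b : (b, _).1 = (b, _).1).
have mono := std_fun_mono (erefl b : (b, _).1 = (b, _).1).
have [iV|iF] := boolP (std_dl (b, i)); have [jV|jF] := boolP (std_dl (b, j)).
- apply: val_inj; case: (ltngtP i j) => // lt.
    by have := mono i j (etrans iV (esym jV)) lt; rewrite e2 ltnn.
  by have := mono j i (etrans jV (esym iV)) lt; rewrite e2 ltnn.
- by have := FV j i jF iV; rewrite e2 ltnn.
- by have := FV i j iF jV; rewrite e2 ltnn.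
have dlE : std_dl (b, i) = std_dl (b, j) by rewrite (negPf iF) (negPf jF).
apply: val_inj; case: (ltngtP i j) => // lt.
  by have := mono i j dlE lt; rewrite e2 ltnn.
by have := mono j i (esym dlE) lt; rewrite e2 ltnn.
Qed.

Definition std_perm : {perm bool * 'I_d} := perm std_fun_inj.

End StandardPermutation.

(** Fits the multiset defining [r2], which consists of two ordered pairs: [Q - v + 2 <= Q - u + 1]
    because [u < v]. *)
Lemma second_smallest_two_pairs (a b c d : nat) : (a <= b)%N -> (c <= d)%N ->
  second_smallest [:: a; b; c; d] = if (a <= c)%N then minn b c else minn a d.
Proof.
move=> ab cd; rewrite /second_smallest /sort /= ab cd /=.
by rewrite /minn; do !case: ifP => //=; lia.
Qed.

(** * A basis of the direct sum *)

Section SumBasis.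
Variables (p : nat) (k : closedFieldType) (chk : p \in [pchar k]) (Q n u v : nat).
Local Notation L := (dsum (M_mod chk Q u v) (dpow (N_mod chk) n)).

Definition inM (x : 'M[k]_(2, Q)) : L := (x, 0).
Definition inN (x : 'M[k]_(2, 1)) (l : nat) : L :=
  (0, [ffun i : 'I_n => if i == l :> nat then x else 0]).

Lemma semi_ext_bvec (r : nat) (tau : {rmorphism k -> k}) phi (i j : nat) :
  (1 <= i <= 2)%N -> (1 <= j <= r)%N ->
  semi_ext (Q := r) tau phi (bvec k r i j) = phi i j.
Proof.
case: i => // i; case: j => // j /= i2 jr.
rewrite /semi_ext (bigD1 (Ordinal i2)) //= [X in _ + X]big1 => [|a ai]; last first.
  apply: big1 => b _; rewrite mxE -(inj_eq val_inj) /= in ai *.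
  by rewrite eqSS (negPf ai) rmorph0 scale0r.
rewrite addr0 (bigD1 (Ordinal jr)) //= big1 => [|b bj]; last first.
  rewrite mxE -(inj_eq val_inj) /= in bj *.
  by rewrite !eqSS (negPf bj) andbF rmorph0 scale0r.
by rewrite mxE /= !eqxx rmorph1 scale1r addr0.
Qed.

Lemma dpow_map_single (f : N_mod chk -> N_mod chk) x l : f 0 = 0 ->
  dpow_map f [ffun i : 'I_n => if i == l :> nat then x else 0] =
  [ffun i : 'I_n => if i == l :> nat then f x else 0].
Proof. by move=> f0; apply/ffunP => i; rewrite !ffunE; case: ifP. Qed.

Lemma dpow_map0 (f : N_mod chk -> N_mod chk) : f 0 = 0 ->
  dpow_map f (0 : {ffun 'I_n -> N_mod chk}) = 0.
Proof. by move=> f0; apply/ffunP => i; rewrite !ffunE. Qed.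

Lemma F_inM i j : (1 <= i <= 2)%N -> (1 <= j <= Q)%N ->
  dmF (inM (bvec k Q i j)) = inM (M_F k Q u v i j).
Proof.
move=> hi hj; rewrite /inM; congr pair; first exact: semi_ext_bvec.
by apply: dpow_map0; apply: semilinear0; apply: dmF_semilinear.
Qed.

Lemma V_inM i j : (1 <= i <= 2)%N -> (1 <= j <= Q)%N ->
  dmV (inM (bvec k Q i j)) = inM (M_V k Q u v i j).
Proof.
move=> hi hj; rewrite /inM; congr pair; first exact: semi_ext_bvec.
by apply: dpow_map0; apply: semilinear0; apply: dmV_semilinear.
Qed.

Lemma F_inN i l : (1 <= i <= 2)%N -> dmF (inN (bvec k 1 i 1) l) = inN (N_FV k i 1) l.
Proof.
move=> hi; rewrite /inN; congr pair.
  by apply: semilinear0; apply: dmF_semilinear.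
apply: etrans (dpow_map_single _ _ (semilinear0 (@dmF_semilinear _ _ _ (N_mod chk)))) _.
by apply/ffunP => a; rewrite !ffunE; case: ifP => // _; apply: semi_ext_bvec.
Qed.

Lemma V_inN i l : (1 <= i <= 2)%N -> dmV (inN (bvec k 1 i 1) l) = inN (N_FV k i 1) l.
Proof.
move=> hi; rewrite /inN; congr pair.
  by apply: semilinear0; apply: dmV_semilinear.
apply: etrans (dpow_map_single _ _ (semilinear0 (@dmV_semilinear _ _ _ (N_mod chk)))) _.
by apply/ffunP => a; rewrite !ffunE; case: ifP => // _; apply: semi_ext_bvec.
Qed.

Lemma inN0 l : inN 0 l = 0.
Proof. by rewrite /inN; congr pair; apply/ffunP => i; rewrite !ffunE if_same. Qed.

(* The copies of [N] are inserted after the first [r b] basis vectors of the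
   graded piece [b] of [M]. *)
Variable r : bool -> nat.

Definition sum_basis (b : bool) (j : nat) : L :=
  let i := if b then 1%N else 2%N in
  if (j <= r b)%N then inM (bvec k Q i j)
  else if (j <= r b + n)%N then inN (bvec k 1 i 1) (j - r b).-1
  else inM (bvec k Q i (j - n)).

Hypothesis rQ : forall b, (r b <= Q)%N.

Lemma sum_basis_grade b j : sum_basis b j \in if b then gd1 L else gd2 L.
Proof.
have dpow0 U : (0 : dpow (N_mod chk) n) \in dpow_vspace n U.
  by apply/mem_dpow_vspace => i; rewrite ffunE mem0v.
rewrite /sum_basis; case: b; do !case: ifP => _;
  rewrite mem_dsum_vspace /= ?bvec_in ?dpow0 ?mem0v //=;
  by apply/(@mem_dpow_vspace _ _ _ (N_mod chk)) => i; rewrite ffunE;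
     case: ifP; rewrite ?bvec_in ?mem0v.
Qed.

Lemma matrix_bvec_sum q (x : 'M[k]_(2, q)) :
  x = \sum_(a < 2) \sum_(b < q) x a b *: bvec k q a.+1 b.+1.
Proof.
apply/matrixP => a b; rewrite summxE (bigD1 a) //= [X in _ + X]big1 => [|a' aa']; last first.
  rewrite summxE big1 // => b' _.
  by rewrite !mxE eqSS (inj_eq val_inj) eq_sym (negPf aa') mulr0.
rewrite addr0 summxE (bigD1 b) //= big1 => [|b' bb']; last first.
  by rewrite !mxE !eqSS !(inj_eq val_inj) [b == b']eq_sym (negPf bb') andbF mulr0.
by rewrite !mxE !eqxx mulr1 addr0.
Qed.

Lemma inM_linear : linear inM.
Proof. by move=> a x y; congr pair; rewrite /= scaler0 addr0. Qed.

Lemma inN_linear l : linear (fun x => inN x l).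
Proof.
move=> a x y; congr pair; first by rewrite /= scaler0 addr0.
by apply/ffunP => i; rewrite !ffunE; case: ifP; rewrite ?scaler0 ?addr0.
Qed.

Lemma linear_mem_bvec q (f : 'M[k]_(2, q) -> L) (U : {vspace L}) :
    linear f ->
    (forall i j, (1 <= i <= 2)%N -> (1 <= j <= q)%N -> f (bvec k q i j) \in U) ->
  forall x, f x \in U.
Proof.
move=> fl fU x; pose g : {linear 'M[k]_(2, q) -> L} :=
  HB.pack f (GRing.isLinear.Build _ _ _ _ _ fl).
rewrite -[f]/(g : _ -> _) (matrix_bvec_sum x) !linear_sum; apply: memv_suml => a _.
rewrite linear_sum; apply: memv_suml => b _; rewrite linearZ; apply: memvZ.
by apply: fU; rewrite /= ltn_ord.
Qed.

Lemma sum_basisP : basis_of {:L} (codom (fun z : bool * 'I_(Q + n) => sum_basis z.1 z.2.+1)).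
Proof.
rewrite basisEdim size_codom card_prod card_bool card_ord; apply/andP; split; last first.
  rewrite dimvf /dim /= dim_matrix -[dim _]/(#|'I_n| * dim 'M[k]_(2, 1))%N dim_matrix card_ord.
  by lia.
(* The family has as many vectors as the dimension, so it remains to show that it spans. *)
set U := <<_>>%VS.
have inU b j : (1 <= j <= Q + n)%N -> sum_basis b j \in U.
  case: j => // j jd; apply: memv_span; apply/codomP.
  by exists (b, Ordinal jd).
have idx i : (1 <= i <= 2)%N -> i = if i == 1%N then 1%N else 2%N by case: eqP; lia.
have MU : forall x, inM x \in U.
  apply: (linear_mem_bvec inM_linear) => i j /idx -> jQ; set b := i == 1%N.
  have [jr|rj] := leqP j (r b).
    by have := inU b j; rewrite /sum_basis jr; apply; lia.
  have := inU b (j + n)%N; rewrite /sum_basis addnK.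
  have -> : (j + n <= r b)%N = false by lia.
  have -> : (j + n <= r b + n)%N = false by lia.
  by apply; lia.
have NU l : (l < n)%N -> forall x, inN x l \in U.
  move=> ln; apply: (linear_mem_bvec (inN_linear l)) => i j /idx -> j1; set b := i == 1%N.
  have -> : j = 1%N by lia.
  have := inU b (r b + l.+1)%N; rewrite /sum_basis.
  have -> : (r b + l.+1 <= r b)%N = false by lia.
  have -> : (r b + l.+1 <= r b + n)%N by lia.
  by rewrite addKn /=; apply; have := rQ b; lia.
apply/subvP => -[x1 x2] _.
have -> : ((x1, x2) : L) = inM x1 + \sum_(l < n) inN (x2 l) l.
  have eN : \sum_(l < n) inN (x2 l) l = (0, x2).
    pose g (l : 'I_n) : {ffun 'I_n -> N_mod chk} :=
      [ffun i : 'I_n => if i == l :> nat then x2 l else 0].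
    have -> : \sum_(l < n) inN (x2 l) l = ((0, \sum_(l < n) g l) : L).
      elim/big_rec2: _ => // l a b _ ->; congr pair; exact: addr0.
    congr pair; apply/ffunP => i; rewrite sum_ffunE (bigD1 i) //= big1 => [|l li].
      by rewrite ffunE eqxx addr0.
    by rewrite ffunE (inj_eq val_inj) eq_sym (negPf li).
  by rewrite eN; congr pair; rewrite /= ?addr0 ?add0r.
by apply: memvD => //; apply: memv_suml => l _; apply: NU.
Qed.

End SumBasis.

(** * The insertion point and the formulas for [F] and [V] *)

Section Insertion.
Variables (Q n u v : nat).
Hypotheses (u1 : (1 <= u)%N) (uv : (u < v)%N) (vQ : (v <= Q)%N).
Local Notation r2 := (second_smallest [:: u; v; (Q - v + 2)%N; (Q - u + 1)%N]).
Local Notation y := (if (u <= r2)%N then u else (u + n)%N).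
Local Notation s := (if (v <= r2)%N then v else (v + n)%N).
Local Open Scope nat_scope.

(** In degree 2 this counts the first [r2] vectors of degree 1 not killed by [F], so that [F] maps
    the part before one insertion onto the part before the other. *)
Definition insertion (b : bool) : nat :=
  if b then r2 else r2 - (u <= r2) - (v <= r2).

(** On the inserted block [F] and [V] must shift positions equally, as they agree on [N]; the common
    shift is 2, 1, 0 in the three cases. The inequalities say which of the thresholds [Q - v + 2]
    and [Q - u + 1] of [V] lie before the block and which move by [n]. *)
Lemma insertion_cases :
  [\/ [/\ insertion true = v, insertion false = v - 2, y = u, s = v & v <= Q - v + 2],
      exists r, [/\ insertion true = r, insertion false = r - 1, y = u, s = v + n &
                    [&& u <= r, r < v, Q - v + 2 <= r & r <= Q - u + 1]]
    | exists r, [/\ insertion true = r, insertion false = r, y = u + n, s = v + n &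
                    [&& r < u, Q - u + 1 <= r & r <= Q]] ].
Proof.
rewrite /insertion; have := @second_smallest_two_pairs u v (Q - v + 2) (Q - u + 1).
move: (second_smallest _) => r /(_ (ltnW uv)) rE.
have {}rE : r = if u <= Q - v + 2 then minn v (Q - v + 2) else minn u (Q - u + 1).
  by apply: rE; lia.
have [vr|rv] := leqP v r; first have -> : u <= r by lia.
  by apply: Or31; split; move: rE vr; rewrite /minn; do !case: ifP => ?; lia.
have [ur|ru] := leqP u r; [apply: Or32 | apply: Or33]; exists r; split=> //=;
  move: rE; rewrite /minn; do !case: ifP => ?; lia.
Qed.

Lemma insertion_le b : insertion b <= Q.
Proof.
by case: insertion_cases => [[]|[r []]|[r []]]; case: b => /= e1 e2 _ _; rewrite ?e1 ?e2; lia.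
Qed.

Variables (p : nat) (k : closedFieldType) (chk : p \in [pchar k]%R).
Local Notation E := (@sum_basis p k chk Q n u v insertion).

(* Innermost conditions first: the positions computed by [std_next] are
   themselves conditional. *)
Ltac split_ifs :=
  match goal with |- context [if ?c then _ else _] =>
    lazymatch c with
    | context [if _ then _ else _] => fail
    | _ => case: (boolP c) => ?; try (exfalso; lia)
    end
  end.
Ltac finish := first [by [] | by rewrite inN0 | by congr (inM _); congr (bvec _ _ _ _); lia
  | by congr (inN _ _); lia ].

Lemma F_sum_basis_cases b j : 1 <= j <= Q + n ->
  dmF (E b j) =
    let i := if b then 1 else 2 in
    if j <= insertion b then inM chk n u v (M_F k Q u v i j)
    else if j <= insertion b + n then inN chk Q n u v (N_FV k i 1) (j - insertion b).-1
    else inM chk n u v (M_F k Q u v i (j - n)).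
Proof.
move=> jd; have := insertion_le b; rewrite /sum_basis /= => le.
have hi : 1 <= (if b then 1 else 2) <= 2 by case: b {le}.
case: b hi le => hi le; do !case: ifP => ?;
  first [apply: F_inN; lia | apply: F_inM; lia].
Qed.

Lemma V_sum_basis_cases b j : 1 <= j <= Q + n ->
  dmV (E b j) =
    let i := if b then 1 else 2 in
    if j <= insertion b then inM chk n u v (M_V k Q u v i j)
    else if j <= insertion b + n then inN chk Q n u v (N_FV k i 1) (j - insertion b).-1
    else inM chk n u v (M_V k Q u v i (j - n)).
Proof.
move=> jd; have := insertion_le b; rewrite /sum_basis /= => le.
have hi : 1 <= (if b then 1 else 2) <= 2 by case: b {le}.
case: b hi le => hi le; do !case: ifP => ?;
  first [apply: V_inN; lia | apply: V_inM; lia].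
Qed.

Lemma F_sum_basis b j : 1 <= j <= Q + n ->
  dmF (E b j) = if std_type (Q + n) y s b j then 0%R
                else E (~~ b) (std_next (Q + n) y s b j).
Proof.
move=> jd; rewrite F_sum_basis_cases // /sum_basis /std_type /std_next /M_F /N_FV.
by case: insertion_cases => [[]|[r []]|[r []]]; case: b => /= -> -> -> -> hyp;
  repeat (split_ifs; rewrite /=); finish.
Qed.

Lemma V_sum_basis b j : 1 <= j <= Q + n ->
  dmV (E (~~ b) (std_next (Q + n) y s b j)) =
    if std_type (Q + n) y s b j then E b j else 0%R.
Proof.
move=> jd; rewrite V_sum_basis_cases; last first.
  by apply: std_next_bounds => //; do !case: ifP => ?; lia.
rewrite /sum_basis /std_type /std_next /M_V /N_FV.
by case: insertion_cases => [[]|[r []]|[r []]]; case: b => /= -> -> -> -> hyp;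
  repeat (split_ifs; rewrite /=); finish.
Qed.

End Insertion.

Theorem theorem4p16 (p : nat) (p_prime : prime p) (p_gt2 : (2 < p)%N)
    (k : closedFieldType) (chk : p \in [pchar k])
    (emb : {rmorphism 'F_p -> k})
    (k_algebraic : forall x : k, algebraicOver emb x)
    (m n u v : nat) (u_ge1 : (1 <= u)%N) (u_lt_v : (u < v)%N)
    (v_le : (v <= m + 2)%N) :
  let Q := (m + 2)%N in
  let L := dsum (M_mod chk Q u v) (dpow (N_mod chk) n) in
  let r2 := second_smallest [:: u; v; (Q - v + 2)%N; (Q - u + 1)%N] in
  let y := if (u <= r2)%N then u else (u + n)%N in
  let s := if (v <= r2)%N then v else (v + n)%N in
  EO_index L (m + n) (gamma (m + n) y s).
Proof.
move=> Q L r2 y s.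
have y1 : (1 <= y)%N by rewrite /y; case: ifP => _; lia.
have ys : (y < s)%N by rewrite /y /s; do !case: ifP => ?; lia.
have sd : (s <= Q + n)%N by rewrite /s; case: ifP => _; lia.
pose pi := std_perm y1 ys sd.
have piE (z : bool * 'I_(Q + n)) : pi z = std_fun y s z by rewrite permE.
pose E (z : bool * 'I_(Q + n)) : L :=
  @sum_basis _ _ chk Q n u v (insertion Q u v) z.1 z.2.+1.
have EpiE z : E (pi z) =
    @sum_basis _ _ chk Q n u v (insertion Q u v) (~~ z.1) (std_next (Q + n) y s z.1 z.2.+1).
  by rewrite /E piE std_funE.
apply: (@EO_index_graded_monomial _ _ _ L _ E pi (std_dl y s)) => //.
- exact/sum_basisP/insertion_le.
- by move=> z; rewrite EpiE; apply: F_sum_basis; rewrite ?ltn_ord.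
- by move=> z; rewrite EpiE; apply: V_sum_basis; rewrite ?ltn_ord.
- by move=> z; apply: sum_basis_grade.
- by move=> z; rewrite piE.
- by move=> z w; rewrite !piE; apply: std_fun_mono.
- by move=> z w; rewrite !piE; apply: std_fun_FV.
by rewrite /Q; lia.
Qed.
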